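(* Let $Y$ be a finite CW complex with $\dim Y>3$ and let $n\ge 2$ be an integer. Then, for any finite CW complex $X$ with $\dim X\ge 1$, there exists a unital homomorphism $\phi: C(X)\to C(Y, M_n)$ which cannot be approximately diagonalized.
   Context: $M_n$ is the algebra of $n\times n$ complex matrices; homomorphisms are $*$-homomorphisms. For compact metrizable spaces $X,Y$, a unital homomorphism $\phi:C(X)\to C(Y,M_n)$ can be approximately diagonalized if for every $\epsilon>0$ and every finite subset $\mathcal F\subset C(X)$ there are continuous maps $\alpha_i:Y\to X$ ($1\le i\le n$) and mutually orthogonal rank one projections $p_1,\dots,p_n\in C(Y,M_n)$ (i.e. $p_i(y)$ has rank one for every $y\in Y$) such that $\|\phi(f)-\sum_{i=1}^n (f\circ\alpha_i)p_i\|<\epsilon$ for all $f\in\mathcal F$. *)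

(* Defs.v *)
From HB Require Import structures.
From mathcomp Require Import all_boot all_order all_algebra.
From mathcomp Require Import complex.
From mathcomp Require Import all_classical all_reals all_analysis.

Set Implicit Arguments.
Unset Strict Implicit.
Unset Printing Implicit Defensive.

Import Order.TTheory GRing.Theory Num.Theory.
Import numFieldNormedType.Exports.

Local Open Scope classical_set_scope.
Local Open Scope ring_scope.

(* The usual topology of the complex numbers R[i], given by the modulus: the
   instances of numFieldNormedType are keyed on abstract structures and are
   not found for the concrete carrier R[i]. *)
#[non_forgetful_inheritance]
HB.instance Definition _ (R : rcfType) := GRing.ComAlgebra.copy R[i] R[i]^o.
#[non_forgetful_inheritance]
HB.instance Definition _ (R : rcfType) := Vector.copy R[i] R[i]^o.
#[non_forgetful_inheritance]
HB.instance Definition _ (R : rcfType) := NormedModule.copy R[i] R[i]^o.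

Section FiniteCW.
Variable R : realType.

Definition sqnorm d (x : 'rV[R]_d) : R := \sum_(i < d) x 0 i ^+ 2.

Definition disk d : set 'rV[R]_d := [set x | sqnorm x <= 1].
Definition open_disk d : set 'rV[R]_d := [set x | sqnorm x < 1].
Definition sphere d : set 'rV[R]_d := [set x | sqnorm x = 1].

(* A finite CW structure on X, in Whitehead's formulation by characteristic
   maps. A map is total on the ambient Euclidean space, but only its values on
   the closed unit disk matter. Closure finiteness is automatic since there are
   finitely many cells. *)
Record finite_cw (X : topologicalType) : Type := FiniteCW {
  cell : finType;
  cell_dim : cell -> nat;
  char_map : forall e : cell, 'rV[R]_(cell_dim e) -> X;
  cw_hausdorff : hausdorff_space X;
  cw_continuous : forall e,
    {within @disk (cell_dim e), continuous (@char_map e)};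
  cw_inj : forall e, set_inj (@open_disk (cell_dim e)) (@char_map e);
  (* with cw_continuous and cw_inj: the open disk is mapped homeomorphically
     onto the open cell *)
  cw_open : forall e (U : set 'rV[R]_(cell_dim e)),
    open U -> U `<=` @open_disk _ ->
    exists2 V : set X, open V &
      @char_map e @` U = V `&` @char_map e @` @open_disk _;
  cw_partition : forall x : X, exists! e, (@char_map e @` @open_disk _) x;
  cw_boundary : forall e, @char_map e @` @sphere _ `<=`
    \bigcup_(e' in [set e' | (cell_dim e' < cell_dim e)%N])
      (@char_map e' @` @open_disk _);
  cw_weak : forall A : set X,
    (forall e, closed (@disk _ `&` @char_map e @^-1` A)) -> closed A
}.

(* 0 for the empty space *)
Definition cw_dim (X : topologicalType) (K : finite_cw X) : nat :=
  \max_(e : cell K) cell_dim e.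

End FiniteCW.

Section CX.
Variables (R : realType) (X : topologicalType).

Lemma conjc_continuous : continuous (fun z : R[i] => z^*%C).
Proof.
move=> z.
apply: (@cvgrPdist_lt _ R[i] _ (nbhs z) (nbhs_filter z) _ _).2 => e e0.
near=> w.
have -> : z^*%C - w^*%C = (z - w)^*%C by rewrite rmorphB.
rewrite (_ : `|(z - w)^*%C| = `|z - w|); last first.
  by case: (z - w) => a b; rewrite !normc_def /= sqrrN.
by near: w; exists e.
Unshelve. all: by end_near. Qed.

Definition cont := continuousType X R[i].

Implicit Types f g : cont.

Fact cont_add_subproof f g : continuous (fun x => f x + g x).
Proof. by move=> x; apply: cvgD; exact: cts_fun. Qed.

Fact cont_mul_subproof f g : continuous (fun x => f x * g x).
Proof. by move=> x; apply: cvgM; exact: cts_fun. Qed.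

Fact cont_scale_subproof (c : R[i]) f : continuous (fun x => c * f x).
Proof. by move=> x; apply: cvgM; [exact: cvg_cst|exact: cts_fun]. Qed.

Fact cont_conj_subproof f : continuous (fun x => (f x)^*%C).
Proof.
by move=> x; apply: continuous_comp; [exact: cts_fun|exact: conjc_continuous].
Qed.

Fact cont_one_subproof : continuous (fun _ : X => 1 : R[i]).
Proof. by move=> x; exact: cvg_cst. Qed.

Definition cont_add f g : cont := mkcts (@cont_add_subproof f g).
Definition cont_mul f g : cont := mkcts (@cont_mul_subproof f g).
Definition cont_scale (c : R[i]) f : cont := mkcts (@cont_scale_subproof c f).
Definition cont_conj f : cont := mkcts (@cont_conj_subproof f).
Definition cont_one : cont := mkcts cont_one_subproof.

End CX.

Section Homomorphisms.
Variables (R : realType) (X Y : topologicalType) (n : nat).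

Definition adjoint (A : 'M[R[i]]_n) : 'M[R[i]]_n := (map_mx conjc A)^T.

Definition vec_norm (v : 'cV[R[i]]_n) : R :=
  Num.sqrt (\sum_(i < n) ComplexField.Normc.normc (v i 0) ^+ 2).

Definition op_norm (A : 'M[R[i]]_n) : \bar R :=
  ereal_sup [set (vec_norm (A *m v))%:E | v in [set v | vec_norm v <= 1]].

Definition sup_norm (F : Y -> 'M[R[i]]_n) : \bar R :=
  ereal_sup [set op_norm (F y) | y in setT].

(* C(Y, M_n), where M_n carries the entrywise topology *)
Definition cont_mx := continuousType Y 'M[R[i]]_n.

Record unital_star_hom (phi : cont R X -> cont_mx) : Prop := UnitalStarHom {
  hom_add : forall f g y, phi (cont_add f g) y = phi f y + phi g y;
  hom_scale : forall c f y, phi (cont_scale c f) y = c *: phi f y;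
  hom_mul : forall f g y, phi (cont_mul f g) y = phi f y *m phi g y;
  hom_star : forall f y, phi (cont_conj f) y = adjoint (phi f y);
  hom_one : forall y, phi (cont_one R X) y = 1%:M
}.

Definition is_projection (p : cont_mx) : Prop :=
  forall y, p y *m p y = p y /\ adjoint (p y) = p y.

Definition approximately_diagonalizable (phi : cont R X -> cont_mx) : Prop :=
  forall (eps : R) (F : set (cont R X)), 0 < eps -> finite_set F ->
  exists (alpha : 'I_n -> continuousType Y X) (p : 'I_n -> cont_mx),
    [/\ forall i, is_projection (p i),
        forall i y, \rank (p i y) = 1%N,
        forall i j, i != j -> forall y, p i y *m p j y = 0 &
        forall f, F f ->
          (sup_norm (fun y => phi f y - \sum_(i < n) f (alpha i y) *: p i y)%R
             < eps%:E)%E].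

End Homomorphisms.

(* Main.v *)
Require Import Defs.
From mathcomp Require Import all_boot all_order all_algebra.
From mathcomp Require Import complex.
From mathcomp Require Import all_classical all_reals all_analysis.
From mathcomp Require Import ring lra.

(* Let [v] be a map from [Y] to R^3 supported on a top cell, and restricting to a
   radial stretching of a projection near the centre of that cell. The traceless
   hermitian 2x2 matrix [v.sigma] has the eigenvalues [|v|] and [-|v|]; composing
   with an arc [gamma] in [X], the functional calculus
   [g |-> g (gamma (v.sigma))], completed by [g (gamma 0)] on the remaining
   coordinates, is a unital homomorphism. If it were approximately diagonalized,
   one of the projections would be defined on a whole ball while being close, on a
   sphere around the origin, to the projection on the positive eigenline of
   [v.sigma], which is the tautological line bundle on the Riemann sphere. Over
   the ball the projection has a nowhere vanishing section, so this bundle would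
   be trivial. It is not: one coordinate of the section does not vanish on the
   upper hemisphere, the other one on the lower hemisphere, hence both have
   continuous square roots along the equator, and so would their ratio, whose
   winding number is one. *)

Set Implicit Arguments.
Unset Strict Implicit.
Unset Printing Implicit Defensive.

Import Order.TTheory GRing.Theory Num.Theory.
Import numFieldNormedType.Exports.

Local Open Scope classical_set_scope.
Local Open Scope ring_scope.
Local Open Scope complex_scope.

Local Notation Re := complex.Re.
Local Notation Im := complex.Im.

(** * Coordinatewise continuity, and fine partitions of a homotopy parameter *)

Lemma continuous_pair (T U V : topologicalType) (f : T -> U) (g : T -> V) :
  continuous f -> continuous g -> continuous (fun x => (f x, g x)).
Proof.
move=> fc gc x.
by have := @cvg_pair _ _ _ (nbhs x) (nbhs (f x)) (nbhs (g x)) _ _ _ f g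
  (fc x) (gc x); apply.
Qed.

Lemma continuous_fst (T U : topologicalType) : continuous (@fst T U).
Proof. by move=> p; exact: cvg_fst. Qed.

Lemma continuous_snd (T U : topologicalType) : continuous (@snd T U).
Proof. by move=> p; exact: cvg_snd. Qed.

Lemma continuous_compose (T U V : topologicalType) (g : U -> V) (f : T -> U) :
  continuous g -> continuous f -> continuous (fun x => g (f x)).
Proof. by move=> gc fc x; exact: (continuous_comp (fc x) (gc (f x))). Qed.

Lemma mx_continuousP (K : puniformType) (T : topologicalType) m n
    (f : T -> 'M[K]_(m, n)) :
  (forall i j, continuous (fun x => f x i j)) -> continuous f.
Proof.
move=> fc x; apply/cvg_mx_entourageP => A entA.
apply: filter_forall => i; apply: filter_forall => j.
have H := (@cvg_entourageP K _ (fmap_filter _ _) _).1 (fc i j x) A entA.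
have {}H := H (nbhs_filter x).
change (nbhs x (fun y => (f x i j, f y i j) \in A)).
change (nbhs x (fun y => A (f x i j, f y i j))) in H.
by apply: filterS H => y /=; rewrite inE.
Qed.

Section ComplexContinuity.
Variable R : realType.

Lemma ReB (z w : R[i]) : Re (z - w) = Re z - Re w.
Proof. by case: z w => [? ?] [? ?]. Qed.
Lemma ImB (z w : R[i]) : Im (z - w) = Im z - Im w.
Proof. by case: z w => [? ?] [? ?]. Qed.

Lemma nbhs_complexP (z : R[i]) (A : set R[i]) :
  nbhs z A <-> exists2 e : R, 0 < e &
    forall w, `|Re z - Re w| < e -> `|Im z - Im w| < e -> A w.
Proof.
split=> [/(@nbhs_normP R[i] R[i] z A)[e /= e0 eA]|[e e0 eA]].
  have [er e0r] : (Im e = 0) /\ 0 < Re e.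
    by move: e0; rewrite ltcE /= => /andP[/eqP-> ->].
  exists (Re e / 2); first by rewrite divr_gt0.
  move=> w zw1 zw2; apply: eA; rewrite /ball_ /=.
  rewrite normc_def ltcE /= er eqxx /= ReB ImB.
  rewrite -[ltRHS]gtr0_norm// -[ltRHS]sqrtr_sqr ltr_sqrt ?exprn_gt0//.
  rewrite -(real_normK (num_real (Re z - _))) -(real_normK (num_real (Im z - _))).
  move: (normr_ge0 (Re z - Re w)) (normr_ge0 (Im z - Im w)) => h1 h2.
  nra.
apply/(@nbhs_normP R[i] R[i] z A); exists (e%:C); first by rewrite /= ltcE /= eqxx.
move=> w; rewrite /ball_ /= normc_def ltcE /= => /andP[_]; rewrite ReB ImB => h.
have aux (x y : R) : `|x| <= Num.sqrt (x ^+ 2 + y ^+ 2).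
  by rewrite -sqrtr_sqr ler_wsqrtr// lerDl sqr_ge0.
apply: eA; first exact: le_lt_trans (aux _ _) h.
by rewrite addrC in h; exact: le_lt_trans (aux _ _) h.
Qed.

Lemma Re_continuous : continuous (fun z : R[i] => Re z).
Proof.
move=> z A /(@nbhs_normP R R (Re z) A)[e /= e0 eA].
by apply/nbhs_complexP; exists e => // w h _; exact: eA.
Qed.

Lemma Im_continuous : continuous (fun z : R[i] => Im z).
Proof.
move=> z A /(@nbhs_normP R R (Im z) A)[e /= e0 eA].
by apply/nbhs_complexP; exists e => // w _ h; exact: eA.
Qed.

Lemma continuous_complexP (T : topologicalType) (f : T -> R[i]) :
  continuous (fun x => Re (f x)) -> continuous (fun x => Im (f x)) ->
  continuous f.
Proof.
move=> fr fi x A /nbhs_complexP[e e0 eA].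
have h1 := (@cvgrPdist_lt R R^o _ _ _ _ _).1 (fr x) e e0.
have h2 := (@cvgrPdist_lt R R^o _ _ _ _ _).1 (fi x) e e0.
near=> y; apply: eA; near: y; [exact: h1|exact: h2].
Unshelve. all: by end_near. Qed.

Lemma real_complex_continuous : continuous (fun x : R => x%:C).
Proof. by apply: continuous_complexP => x; [exact: cvg_id|exact: cvg_cst]. Qed.


Lemma continuous_mx_entry (T : topologicalType) m n (f : T -> 'M[R[i]]_(m, n)) i j :
  continuous f -> continuous (fun x => f x i j).
Proof.
move=> fc x; apply: (@continuous_comp _ _ _ f (fun M => M i j)); first exact: fc.
exact: (@coord_continuous R[i] m n i j).
Qed.

Lemma continuous_Re (T : topologicalType) (f : T -> R[i]) :
  continuous f -> continuous (fun x => Re (f x)).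
Proof. by move=> fc x; exact: (continuous_comp (fc x) (@Re_continuous (f x))). Qed.

Lemma continuousCD (T : topologicalType) (f g : T -> R[i]) :
  continuous f -> continuous g -> continuous (fun x => f x + g x).
Proof. by move=> fc gc x; apply: cvgD; [exact: fc|exact: gc]. Qed.
Lemma continuousCM (T : topologicalType) (f g : T -> R[i]) :
  continuous f -> continuous g -> continuous (fun x => f x * g x).
Proof. by move=> fc gc x; apply: cvgM; [exact: fc|exact: gc]. Qed.
Lemma continuousRD (T : topologicalType) (f g : T -> R) :
  continuous f -> continuous g -> continuous (fun x => f x + g x).
Proof. by move=> fc gc x; apply: (@cvgD R R^o); [exact: fc|exact: gc]. Qed.

Lemma continuousRB (T : topologicalType) (f g : T -> R) :
  continuous f -> continuous g -> continuous (fun x => f x - g x).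
Proof. by move=> fc gc x; apply: (@cvgB R R^o); [exact: fc|exact: gc]. Qed.

Lemma continuousRM (T : topologicalType) (f g : T -> R) :
  continuous f -> continuous g -> continuous (fun x => f x * g x).
Proof. by move=> fc gc x; apply: (@cvgM R); [exact: fc|exact: gc]. Qed.

Lemma continuousRV (T : topologicalType) (f : T -> R) :
  (forall x, f x != 0) -> continuous f -> continuous (fun x => (f x)^-1).
Proof.
move=> f0 fc x.
exact: (continuous_comp (fc x) (inv_continuous (f0 x))).
Qed.

Lemma continuousC_sum (T : topologicalType) (I : Type) (r : seq I) (f : I -> T -> R[i]) :
  (forall i, continuous (f i)) -> continuous (fun x => \sum_(i <- r) f i x).
Proof.
move=> fc; elim: r => [|i r ih].
  by under eq_fun do rewrite big_nil; move=> x; exact: cvg_cst.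
rewrite (_ : (fun x => _) = fun x => f i x + \sum_(i <- r) f i x).
  exact: continuousCD (fc i) ih.
by apply/funext => x; rewrite big_cons.
Qed.
End ComplexContinuity.

(** By compactness, positivity on the diagonal spreads to all pairs of parameters closer than a
    single [d], and neighbours in a partition of mesh below [d] are such pairs. It discretizes
    homotopies of loops as well as paths of idempotents. *)
Lemma compact_fine_partition (R : realType) (T : topologicalType)
    (K : set T) (f : R -> R -> T -> R) :
  compact K -> continuous (fun p : R * R * T => f p.1.1 p.1.2 p.2) ->
  (forall s k, 0 <= s <= 1 -> K k -> 0 < f s s k) ->
  exists2 N : nat, (0 < N)%N & forall i k, (i < N)%N -> K k ->
    0 < f (i%:R / N%:R) (i.+1%:R / N%:R) k.
Proof.
move=> cK cf f0.
have cQ : compact (`[0, 1] `*` K : set (R * T)).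
  by apply: compact_setX => //; exact: segment_compact.
pose P (d : R) (p : R * T) := forall s', `|p.1 - s'| < d -> 0 < f p.1 s' p.2.
have H : \forall d \near 0^'+, (`[0, 1] `*` K) `<=` P d.
  apply: ((compact_near_coveringP _).1 cQ).
  move=> [s k] [/= s01 Kk].
  have fs : 0 < f s s k by apply: f0 => //; move: s01; rewrite /= in_itv.
  have := cf (s, s, k) _ (open_nbhs_nbhs (conj (@open_gt R 0) fs)).
  move=> [[U V] /= [[[U1 U2] /= [nU1 nU2] sU] nV] sUV].
  have [e /= e0 eU] := (@nbhs_normP R R _ _).1 nU1.
  have [e' /= e'0 eU'] := (@nbhs_normP R R _ _).1 nU2.
  (* [s1] lies within [e' / 2] of [s], and [s'] within [d < e' / 2] of [s1], so [s'] stays in the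
     [e']-ball around [s]. *)
  exists (ball s (Num.min e (e' / 2)) `*` V, [set d | d < e' / 2]) => /=.
    split; last by apply: nbhs_right_lt; rewrite divr_gt0.
    exists (ball s (Num.min e (e' / 2)), V) => //=; split => //.
    by apply: nbhsx_ballx; rewrite lt_min e0 divr_gt0.
  move=> [[s1 k1] d] /= [[]]; rewrite /ball /= lt_min => /andP[h1 h2] Vk dl s' s's.
  apply: (sUV ((s1, s'), k1)); split => //=.
  apply: sU; split => /=; first exact: eU.
  apply: eU'; rewrite /ball_ /=.
  have -> : s - s' = (s - s1) + (s1 - s') by ring.
  by apply: le_lt_trans (ler_normD _ _) _; lra.
have [d d0 Pd] : exists2 d : R, 0 < d & (`[0, 1] `*` K) `<=` P d.
  near (0 : R)^'+ => d; exists d; first by near: d; exact: nbhs_right_gt.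
  by near: d.
pose N := (Num.trunc d^-1).+1.
have N0 : 0 < N%:R :> R by rewrite ltr0n.
have dN : N%:R^-1 < d.
  by rewrite invf_plt ?posrE// /N truncnS_gt.
exists N => // i k iN Kk; apply: (Pd (i%:R / N%:R, k)) => /=.
  split => //=; rewrite in_itv /= divr_ge0 ?ler0n//= ler_pdivrMr// mul1r.
  by rewrite ler_nat ltnW.
rewrite -mulrBl -natr1 opprD addrA subrr add0r mulN1r normrN gtr0_norm//.
by rewrite invr_gt0.
Unshelve. all: by end_near. Qed.

(** * The winding number modulo two, through continuous square roots *)

Section ContinuousSquareRoots.
Variable R : realType.
Implicit Types g h : R -> R[i].

Definition has_square_root g := exists h, [/\ continuous h, h 1 = h (-1) &
  forall t, -1 <= t <= 1 -> exists2 c : R, 0 < c & h t ^+ 2 = c%:C * g t].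

Lemma continuous_conj (T : topologicalType) (f : T -> R[i]) :
  continuous f -> continuous (fun x => (f x)^*).
Proof.
move=> fc x; apply: (@continuous_comp _ _ _ f conjc); first exact: fc.
exact: conjc_continuous.
Qed.

Lemma continuous_normC (T : topologicalType) (f : T -> R[i]) :
  continuous f -> continuous (fun x => `|f x|).
Proof.
move=> fc x; apply: (@continuous_comp _ _ _ f (fun z => `|z|)); first exact: fc.
exact: (@norm_continuous R[i] R[i]^o).
Qed.

(* [(u + |u|)^2 = 2 (Re u + |u|) u], so [u + |u|] is a positive multiple of the
   principal square root of [u]. *)
Lemma has_square_root_step g1 g2 :
  continuous g1 -> continuous g2 -> g1 1 = g1 (-1) -> g2 1 = g2 (-1) ->
  (forall t, -1 <= t <= 1 -> 0 < Re (g2 t * (g1 t)^*)) ->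
  has_square_root g1 -> has_square_root g2.
Proof.
move=> c1 c2 e1 e2 pos [h [ch eh hg]].
pose u t := g2 t * (g1 t)^*.
have cu : continuous u := continuousCM c2 (continuous_conj c1).
exists (fun t => h t * (u t + `|u t|)); split.
- exact: continuousCM ch (continuousCD cu (continuous_normC cu)).
- by rewrite /u eh e1 e2.
move=> t t1; have [c c0 hc] := hg t t1.
have ut := pos t t1; rewrite -/(u t) in ut.
set n := Num.sqrt (Re (u t) ^+ 2 + Im (u t) ^+ 2).
have n0 : 0 <= n by exact: sqrtr_ge0.
have nn : n ^+ 2 = Re (u t) ^+ 2 + Im (u t) ^+ 2.
  by rewrite sqr_sqrtr// addr_ge0 ?sqr_ge0.
have g10 : 0 < Re (g1 t) ^+ 2 + Im (g1 t) ^+ 2.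
  rewrite lt_neqAle addr_ge0 ?sqr_ge0// andbT eq_sym paddr_eq0 ?sqr_ge0//.
  rewrite !sqrf_eq0; apply/negP => /andP[/eqP a0 /eqP b0]; move: ut.
  by rewrite /u; case: (g1 t) (g2 t) a0 b0 => a b [a' b'] /= -> ->; rewrite oppr0 !mulr0 subrr ltxx.
(* The factors come from [h ^ 2 = c g1], from the square of [u + |u|], and from
   [g1 u = |g1|^2 g2]. *)
exists (c * (2 * (Re (u t) + n)) * (Re (g1 t) ^+ 2 + Im (g1 t) ^+ 2)).
  by rewrite !mulr_gt0// ltr_wpDr.
rewrite exprMn hc normc_def -/n.
have -> : (u t + n%:C) ^+ 2 = (2 * (Re (u t) + n))%:C * u t.
  case: (u t) nn => a b /= nn; rewrite expr2; simpc.
  by apply/eqP; rewrite eq_complex /=; apply/andP; split; apply/eqP; nra.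
rewrite /u; case: (g1 t) (g2 t) => a b [a' b'] /=.
by simpc; apply/eqP; rewrite eq_complex /=; apply/andP; split; apply/eqP; ring.
Qed.

(** Up to a positive factor [k] is the quotient [h / w], and its square is positive. So [Re k] has
    no zero on [-1, 1], although [k] changes sign between the end points, [h] being periodic and [w]
    anti-periodic. *)
Lemma no_square_root (w : R -> R[i]) :
  continuous w -> w 1 = - w (-1) -> (forall t, -1 <= t <= 1 -> w t != 0) ->
  ~ has_square_root (fun t => w t ^+ 2).
Proof.
move=> cw ew w0 [h [ch eh hw]].
pose k t := h t * (w t)^*.
have ck : continuous k := continuousCM ch (continuous_conj cw).
have ek : k 1 = - k (-1) by rewrite /k eh ew rmorphN mulrN.
have k0 t : -1 <= t <= 1 -> Re (k t) != 0.
  move=> t1; have [c c0 hc] := hw t t1; have := w0 t t1.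
  have : k t ^+ 2 = c%:C * (w t * (w t)^*) ^+ 2 by rewrite exprMn hc; ring.
  case: (k t) (w t) => a b [x y] /=; rewrite !expr2 eq_complex; simpc.
  move=> /eqP; rewrite eq_complex /= => /andP[/eqP e1 /eqP e2] n0.
  apply/eqP => a0; subst a.
  have : 0 < x ^+ 2 + y ^+ 2.
    rewrite lt_neqAle addr_ge0 ?sqr_ge0// andbT eq_sym paddr_eq0 ?sqr_ge0//.
    by rewrite !sqrf_eq0.
  move=> q0; have : 0 < c * (x ^+ 2 + y ^+ 2) ^+ 2 by rewrite mulr_gt0// exprn_gt0.
  have -> : c * (x ^+ 2 + y ^+ 2) ^+ 2 = 0 * 0 - b * b by rewrite e1; ring.
  by rewrite mul0r sub0r oppr_gt0 -expr2 ltNge sqr_ge0.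
have cRk : continuous (fun t => Re (k t)) := continuous_Re ck.
have [c] : exists2 c, c \in `[(-1), 1]%R & Re (k c) = 0.
  apply: (@IVT R (fun t => Re (k t))); first lra.
    exact: continuous_subspaceT.
  rewrite ek; case: (k (-1)) => a b /=.
  by case: (lerP a (- a)) => h1; apply/andP; split; lra.
by rewrite in_itv /= => /k0/eqP.
Qed.

(** For close parameters [s] and [s'] the product of [G s' t] with the conjugate of [G s t] has
    positive real part, so the square root is carried along a fine partition by
    [has_square_root_step]. *)
Lemma has_square_root_homotopy (G : R -> R -> R[i]) :
  continuous (fun p : R * R => G p.1 p.2) ->
  (forall s, G s 1 = G s (-1)) ->
  (forall s t, 0 <= s <= 1 -> -1 <= t <= 1 -> G s t != 0) ->
  has_square_root (G 0) -> has_square_root (G 1).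
Proof.
move=> cG eG G0 sq0.
pose f (s s' t : R) := Re (G s' t * (G s t)^*).
have cf : continuous (fun p : R * R * R => f p.1.1 p.1.2 p.2).
  have c1 : continuous (fun p : R * R * R => (p.1.2, p.2)).
    apply: continuous_pair; last exact: continuous_snd.
    exact: continuous_compose (@continuous_snd _ _) (@continuous_fst _ _).
  have c2 : continuous (fun p : R * R * R => (p.1.1, p.2)).
    apply: continuous_pair; last exact: continuous_snd.
    exact: continuous_compose (@continuous_fst _ _) (@continuous_fst _ _).
  exact: (continuous_Re (continuousCM (continuous_compose cG c1)
    (continuous_conj (continuous_compose cG c2)))).
have f0 s t : 0 <= s <= 1 -> `[-1, 1]%classic t -> 0 < f s s t.
  rewrite /= in_itv /= => s1 t1; have := G0 s t s1 t1.
  rewrite /f; case: (G s t) => a b; rewrite eq_complex /= mulrN opprK -!expr2 => ab.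
  rewrite lt_neqAle addr_ge0 ?sqr_ge0// andbT eq_sym paddr_eq0 ?sqr_ge0//.
  by rewrite !sqrf_eq0.
have [N N0 HN] := compact_fine_partition (@segment_compact R (-1) 1) cf f0.
have cGs s : continuous (G s).
  have cs : continuous (fun t : R => (s, t)).
    by apply: continuous_pair => t; [exact: cvg_cst|exact: cvg_id].
  exact: (continuous_compose cG cs).
have H i : (i <= N)%N -> has_square_root (G (i%:R / N%:R)).
  elim: i => [|i ih] iN; first by rewrite mul0r.
  apply: has_square_root_step (ih (ltnW iN)) => // t t1.
  by apply: HN => //=; rewrite in_itv.
by have := H N (leqnn N); rewrite divff ?pnatr_eq0 -?lt0n.
Qed.

End ContinuousSquareRoots.

(** * Nowhere vanishing sections of families of idempotents *)

Lemma continuousC_prod (R : realType) (T : topologicalType) (I : Type) (r : seq I)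
    (f : I -> T -> R[i]) :
  (forall i, continuous (f i)) -> continuous (fun x => \prod_(i <- r) f i x).
Proof.
move=> fc; elim: r => [|i r ih].
  by under eq_fun do rewrite big_nil; move=> x; exact: cvg_cst.
rewrite (_ : (fun x => _) = fun x => f i x * \prod_(i <- r) f i x).
  exact: continuousCM (fc i) ih.
by apply/funext => x; rewrite big_cons.
Qed.

Lemma continuousC_cst (R : realType) (T : topologicalType) (c : R[i]) :
  continuous (fun _ : T => c).
Proof. by move=> x; exact: cvg_cst. Qed.

Lemma continuous_det (R : realType) (T : topologicalType) n
    (A : T -> 'M[R[i]]_n) :
  (forall i j, continuous (fun x => A x i j)) -> continuous (fun x => \det (A x)).
Proof.
move=> cA; apply: continuousC_sum => s; apply: continuousCM.
  exact: continuousC_cst.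
by apply: continuousC_prod => i; exact: cA.
Qed.

Lemma continuous_mulmx (R : realType) (T : topologicalType) m n p
    (A : T -> 'M[R[i]]_(m, n)) (B : T -> 'M[R[i]]_(n, p)) :
  (forall i j, continuous (fun x => A x i j)) ->
  (forall i j, continuous (fun x => B x i j)) ->
  forall i j, continuous (fun x => (A x *m B x) i j).
Proof.
move=> cA cB i j.
rewrite (_ : (fun x => _) = fun x => \sum_k A x i k * B x k j); last first.
  by apply/funext => x; rewrite mxE.
by apply: continuousC_sum => k; apply: continuousCM; [exact: cA|exact: cB].
Qed.

(* A vector [v] fixed by [A] and killed by [B] is fixed by [A - B], so it
   vanishes once [1 - A + B] is invertible: projecting successively along a
   fine partition never yields zero. *)
Lemma idempotent_section (R : realType) (T : topologicalType) (K : set T) n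
    (P : R -> T -> 'M[R[i]]_n) (P0 : 'M[R[i]]_n) :
  compact K -> (forall i j, continuous (fun p : R * T => P p.1 p.2 i j)) ->
  (forall s k, P s k *m P s k = P s k) ->
  (forall k, P 0 k = P0) -> P0 != 0 ->
  exists v : T -> 'cV[R[i]]_n,
    [/\ forall i, continuous (fun k => v k i 0),
        forall k, P 1 k *m v k = v k,
        forall k, K k -> v k != 0 &
        forall k k', (forall s, P s k = P s k') -> v k = v k'].
Proof.
move=> cK cP PP PC P00.
pose D s s' k := \det (1%:M - P s k + P s' k).
(* The squared modulus of the determinant turns invertibility into the positivity required by
   [compact_fine_partition]; on the diagonal the determinant is 1. *)
pose f s s' k := Re (D s s' k * (D s s' k)^*).
have cD : continuous (fun p : R * R * T => D p.1.1 p.1.2 p.2).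
  have c2 : continuous (fun p : R * R * T => (p.1.2, p.2)).
    apply: continuous_pair; last exact: continuous_snd.
    exact: continuous_compose (@continuous_snd _ _) (@continuous_fst _ _).
  have c1 : continuous (fun p : R * R * T => (p.1.1, p.2)).
    apply: continuous_pair; last exact: continuous_snd.
    exact: continuous_compose (@continuous_fst _ _) (@continuous_fst _ _).
  apply: continuous_det => i j.
  rewrite (_ : (fun x => _) = fun x : R * R * T =>
    ((1%:M : 'M[R[i]]_n) i j + (-1) * P x.1.1 x.2 i j) + P x.1.2 x.2 i j); last first.
    by apply/funext => x; rewrite !mxE mulN1r.
  exact: (continuousCD (continuousCD (@continuousC_cst _ _ _)
    (continuousCM (@continuousC_cst _ _ _) (continuous_compose (cP i j) c1)))
    (continuous_compose (cP i j) c2)).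
have cf : continuous (fun p : R * R * T => f p.1.1 p.1.2 p.2).
  exact: (continuous_Re (continuousCM cD (continuous_conj cD))).
have f0 s k : 0 <= s <= 1 -> K k -> 0 < f s s k.
  move=> _ _; rewrite /f /D addrNK det1 /= mul1r oppr0 mulr0 subr0.
  exact: ltr01.
have [N N0 HN] := compact_fine_partition cK cf f0.
have H i : (i <= N)%N -> exists v : T -> 'cV[R[i]]_n,
    [/\ forall j, continuous (fun k => v k j 0),
        forall k, P (i%:R / N%:R) k *m v k = v k,
        forall k, K k -> v k != 0 &
        forall k k', (forall s, P s k = P s k') -> v k = v k'].
  elim: i => [|i ih] iN.
    (* A nonzero column of [P0] is fixed by [P0], and serves as the constant initial section. *)
    have [j j0] : exists j, col j P0 != 0.
      apply: contra_notP (negP P00) => /forallNP h; apply/eqP/matrixP => a b.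
      by have /negP/negPn/eqP/matrixP/(_ a 0) := h b; rewrite !mxE.
    exists (fun=> col j P0); split => //.
      by move=> a; exact: continuousC_cst.
    by move=> k; rewrite mul0r PC colE mulmxA -{1 2 3}(PC k) PP PC.
  have [v [cv Pv v0 ev]] := ih (ltnW iN).
  have cPi a b : continuous (fun k => P (i.+1%:R / N%:R) k a b).
    have c : continuous (fun k : T => (i.+1%:R / N%:R : R, k)).
      by apply: continuous_pair => t; [exact: cvg_cst|exact: cvg_id].
    exact: continuous_compose (cP a b) c.
  exists (fun k => P (i.+1%:R / N%:R) k *m v k); split.
  - by move=> j; apply: continuous_mulmx => // a b; rewrite (ord1 b).
  - by move=> k; rewrite mulmxA PP.
  - move=> k Kk; apply: contra (v0 k Kk) => /eqP Pv0.
    have := HN i k iN Kk; rewrite /f.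
    set d := D _ _ _ => d0.
    have dU : 1%:M - P (i%:R / N%:R) k + P (i.+1%:R / N%:R) k \in unitmx.
      rewrite unitmxE unitfE; apply/eqP => d00.
      by move: d0; rewrite /d /D d00 mul0r ltxx.
    have /eqP : (1%:M - P (i%:R / N%:R) k + P (i.+1%:R / N%:R) k) *m v k = 0.
      by rewrite mulmxDl mulmxBl mul1mx Pv Pv0 subrr addr0.
    by move=> /eqP e; rewrite -[v k](mulKmx dU) e mulmx0.
  - by move=> k k' e; rewrite e (ev _ _ e).
have [v] := H N (leqnn N).
by rewrite divff ?pnatr_eq0 -?lt0n// => hv; exists v.
Qed.

(** * Extending maps from a top cell to the whole complex *)

Section TopCell.
Variables (R : realType) (X : topologicalType) (K : finite_cw R X).

Lemma sqnorm_continuous d : continuous (@sqnorm R d).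
Proof.
rewrite /sqnorm; elim: (index_enum _) => [|i r ih].
  rewrite (_ : (fun _ => _) = fun=> 0); first exact: cst_continuous.
  by apply/funext => x; rewrite big_nil.
rewrite (_ : (fun _ => _) = fun x : 'rV[R]_d =>
    x 0 i * x 0 i + \sum_(j <- r) x 0 j ^+ 2).
  have c : continuous (fun x : 'rV[R]_d => x 0 i) by exact: coord_continuous.
  exact: continuousRD (continuousRM c c) ih.
by apply/funext => x; rewrite big_cons expr2.
Qed.

Lemma closed_disk d : closed (@disk R d).
Proof.
apply: (@closed_comp _ _ (@sqnorm R d) [set x | x <= 1]); last exact: closed_le.
by move=> x _; exact: sqnorm_continuous.
Qed.

Lemma top_cell : (0 < cw_dim K)%N -> exists2 e : cell K,
  cell_dim e = cw_dim K & forall e' : cell K, (cell_dim e' <= cell_dim e)%N.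
Proof.
move=> K0.
have K0' : (0 < #|cell K|)%N.
  rewrite lt0n; apply: contraTneq K0 => c0; rewrite /cw_dim big1 // => e _.
  by have := card0_eq c0 e; rewrite !inE.
have [e ee] := @bigop.eq_bigmax (cell K) (@cell_dim R X K) K0'.
by exists e => [|e']; rewrite /cw_dim -?ee //; exact: (@bigop.leq_bigmax (cell K)).
Qed.

(** Being constant on the boundary sphere, [g] extends by [z0] outside the open cell. Maximality of
    the dimension keeps all other closed cells away from this open cell, so the extension is
    constant on each of them, and the weak topology gives continuity. *)
Lemma extend_top_cell (e : cell K) (Z : topologicalType)
    (g : 'rV[R]_(cell_dim e) -> Z) (z0 : Z) :
  (forall e' : cell K, (cell_dim e' <= cell_dim e)%N) -> continuous g ->
  (forall w, sqnorm w = 1 -> g w = z0) ->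
  exists2 F : X -> Z, continuous F & forall w, sqnorm w <= 1 -> F (char_map w) = g w.
Proof.
move=> top cg gz.
have part e1 e2 w1 w2 : @open_disk R (cell_dim e1) w1 ->
    @open_disk R (cell_dim e2) w2 -> @char_map _ _ K e1 w1 = @char_map _ _ K e2 w2 -> e1 = e2.
  move=> h1 h2 h; have [e3 [_ u]] := cw_partition K (@char_map _ _ K e1 w1).
  have u1 := u e1 (imageP (@char_map _ _ K e1) h1).
  rewrite h in u; have u2 := u e2 (imageP (@char_map _ _ K e2) h2).
  exact: etrans (esym u1) u2.
(* Boundary points of [e'] land in open cells of dimension below that of [e'], hence never in the
   open cell of [e]. *)
have bd e' w : @sphere R (cell_dim e') w -> forall w', @open_disk R (cell_dim e) w' ->
    @char_map _ _ K e' w <> @char_map _ _ K e w'.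
  move=> h w' h' eq.
  have [e'' /= lt [w'' h'' eq'']] := @cw_boundary _ _ K e' _ (imageP (@char_map _ _ K e') h).
  have e_ : e'' = e by apply: part h'' h' _; rewrite eq''.
  by move: lt; rewrite e_ ltnNge top.
have dsk d (w : 'rV[R]_d) : @disk R d w -> @open_disk R d w \/ @sphere R d w.
  by rewrite /disk /open_disk /sphere /= le_eqVlt => /orP[/eqP|]; [right|left].
have fn w w' : @disk R (cell_dim e) w -> @disk R (cell_dim e) w' ->
    @char_map _ _ K e w = @char_map _ _ K e w' -> g w = g w'.
  move=> /dsk[h|h] /dsk[h'|h'] eq.
  - by congr g; apply: (@cw_inj _ _ K e w w') eq; rewrite inE.
  - by case: (bd _ _ h' _ h).
  - by case: (bd _ _ h _ h').
  - by rewrite !gz.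
(* The value at [x] is read off any preimage in the closed disk, which is unambiguous by [fn];
   elsewhere it is [z0]. The two clauses agree on the image of the sphere. *)
have /choice[F HF] : forall x, exists z,
    (forall w, @disk R (cell_dim e) w -> @char_map _ _ K e w = x -> z = g w) /\
    ((forall w, @open_disk R (cell_dim e) w -> @char_map _ _ K e w <> x) -> z = z0).
  move=> x; have [[w [hw wx]]|N] := pselect (exists w, @disk R (cell_dim e) w /\ @char_map _ _ K e w = x).
    exists (g w); split=> [w' hw' w'x|N]; first by apply: fn => //; rewrite wx.
    by case: (dsk _ _ hw) => [/N//|]; exact: gz.
  by exists z0; split => // w hw wx; case: N; exists w.
exists F; last by move=> w hw; have [+ _] := HF (char_map w); apply.
apply/continuous_closedP => A cA; refine (@cw_weak _ _ K (F @^-1` A) _) => e'.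
have [ee|ee] := eqVneq e' e.
  subst e'; rewrite (_ : _ `&` _ = @disk R (cell_dim e) `&` g @^-1` A).
    apply: closedI; first exact: closed_disk.
    by move/continuous_closedP: cg; apply.
  apply/seteqP; split => w /= [hw]; have [+ _] := HF (char_map w);
    by move=> /(_ w hw erefl) ->.
have Fz w : @disk R (cell_dim e') w -> F (char_map w) = z0.
  move=> hw; have [_] := HF (char_map w); apply => w' hw' eq.
  case: (dsk _ _ hw) => h; last by case: (bd _ _ h _ hw').
  by move/eqP: ee; apply; apply: part h hw' _.
have [Az|Az] := pselect (A z0).
  rewrite (_ : _ `&` _ = @disk R (cell_dim e')); first exact: closed_disk.
  by apply/seteqP; split => w /= => [[]//|hw]; split => //; rewrite /preimage /= Fz.
rewrite (_ : _ `&` _ = set0); first exact: closed0.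
by apply/seteqP; split => w //= [hw]; rewrite /preimage /= Fz.
Qed.

Lemma sqnormZ d (a : R) (w : 'rV[R]_d) : sqnorm (a *: w) = a ^+ 2 * sqnorm w.
Proof. by rewrite /sqnorm mulr_sumr; apply: eq_bigr => i _; rewrite mxE exprMn. Qed.

Lemma sqnorm_ge0 d (w : 'rV[R]_d) : 0 <= sqnorm w.
Proof. by apply: sumr_ge0 => i _; exact: sqr_ge0. Qed.

(* Contracts the whole space into the open disk, so that [char_map \o shrink] is
   continuous everywhere, and not only within the disk. *)
Definition shrink d (w : 'rV[R]_d) : 'rV[R]_d := (1 + sqnorm w)^-1 *: w.

Lemma sqnorm_shrink d (w : 'rV[R]_d) : sqnorm (shrink w) < 1.
Proof.
have w0 := sqnorm_ge0 w.
rewrite /shrink sqnormZ exprVn mulrC ltr_pdivrMr ?exprn_gt0 ?ltr_wpDr// mul1r.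
nra.
Qed.

Lemma continuous_shrink d : continuous (@shrink d).
Proof.
apply: mx_continuousP => i j.
rewrite (_ : (fun _ => _) = fun w : 'rV[R]_d => (1 + sqnorm w)^-1 * w i j); last first.
  by apply/funext => w; rewrite mxE.
apply: continuousRM; last exact: coord_continuous.
apply: continuousRV => [w|]; first by rewrite gt_eqF// ltr_wpDr// sqnorm_ge0.
by apply: continuousRD; [exact: cst_continuous|exact: sqnorm_continuous].
Qed.

Lemma continuous_char_map_shrink (e : cell K) :
  continuous (fun w : 'rV[R]_(cell_dim e) => char_map (shrink w)).
Proof.
move=> w A /= nA.
have wd : @disk R _ (shrink w) by rewrite /disk /= ltW// sqnorm_shrink.
have /(_ (shrink w)) := (subspace_continuousP _ _).1 (@cw_continuous _ _ K e).
move=> /(_ wd A nA) /= H.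
have H' := @continuous_shrink _ w _ H.
change (nbhs w (fun w' => A (char_map (shrink w')))).
apply: (@filterS _ (nbhs w) _ _ _ _ H') => w' /=; apply.
by rewrite /disk /= ltW// sqnorm_shrink.
Qed.

End TopCell.

(** * Functional calculus of a field of traceless hermitian matrices *)

Lemma corner_calculus (K : comNzRingType) n (E U : 'M[K]_n) (a b c a' b' c' : K) :
  E *m E = E -> E *m U = U -> U *m E = U -> (b * b') *: (U *m U) = (b * b') *: E ->
  (a *: E + b *: U + c *: (1%:M - E)) *m (a' *: E + b' *: U + c' *: (1%:M - E)) =
  (a * a' + b * b') *: E + (a * b' + b * a') *: U + (c * c') *: (1%:M - E).
Proof.
move=> EE EU UE UU.
rewrite !mulmxDl !mulmxDr -!scalemxAl -!scalemxAr !scalerA UU.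
rewrite !mulmxBl !mulmxBr !mul1mx !mulmx1 EE UE EU.
rewrite !subrr !subr0 !scaler0 !addr0 !add0r !scalerDl.
rewrite -!addrA; congr (_ + _); rewrite !addrA; congr (_ + _).
by rewrite addrC addrA.
Qed.

Lemma adjointD (R : realType) n (A B : 'M[R[i]]_n) :
  adjoint (A + B) = adjoint A + adjoint B.
Proof. by rewrite /adjoint map_mxD linearD. Qed.

Lemma adjointB (R : realType) n (A B : 'M[R[i]]_n) :
  adjoint (A - B) = adjoint A - adjoint B.
Proof. by rewrite /adjoint map_mxB linearB. Qed.

Lemma adjointZ (R : realType) n (a : R[i]) (A : 'M[R[i]]_n) :
  adjoint (a *: A) = a^* *: adjoint A.
Proof. by apply/matrixP => i j; rewrite !mxE rmorphM. Qed.

Lemma adjoint1 (R : realType) n : adjoint (1%:M : 'M[R[i]]_n) = 1%:M.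
Proof. by apply/matrixP => i j; rewrite !mxE conjc_nat eq_sym. Qed.

Section PauliHomomorphism.
Variables (R : realType) (X Y : topologicalType) (n : nat).
Variables (gamma : R -> X) (v0 v1 v2 : Y -> R).
Hypothesis gamma_cont : continuous gamma.
Hypotheses (v0_cont : continuous v0) (v1_cont : continuous v1)
  (v2_cont : continuous v2).

Definition pauli_radius y := Num.sqrt (v0 y ^+ 2 + v1 y ^+ 2 + v2 y ^+ 2).

Lemma pauli_radius_continuous : continuous pauli_radius.
Proof.
apply: (continuous_compose (@sqrt_continuous R)).
rewrite (_ : (fun _ => _) = fun y => v0 y * v0 y + v1 y * v1 y + v2 y * v2 y).
  exact: continuousRD (continuousRD (continuousRM v0_cont v0_cont)
    (continuousRM v1_cont v1_cont)) (continuousRM v2_cont v2_cont).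
by apply/funext => y; rewrite !expr2.
Qed.

Lemma pauli_radius_sqr y : pauli_radius y ^+ 2 = v0 y ^+ 2 + v1 y ^+ 2 + v2 y ^+ 2.
Proof. by rewrite sqr_sqrtr// !addr_ge0 ?sqr_ge0. Qed.

(** The combination of the three Pauli matrices with coefficients [v0], [v1], [v2]; indexing by
    [nat] pads it with zeros to any size. *)
Definition pauli_entry y (i j : nat) : R[i] :=
  match i, j with
  | O, O => (v2 y)%:C
  | O, S O => v0 y -i* v1 y
  | S O, O => v0 y +i* v1 y
  | S O, S O => (- v2 y)%:C
  | _, _ => 0
  end.

Lemma pauli_entry_continuous i j : continuous (fun y => pauli_entry y i j).
Proof.
case: i => [|[|i]] /=; case: j => [|[|j]] /=; try exact: cst_continuous;
  apply: continuous_complexP => //=; try exact: cst_continuous.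
- by move=> y; apply: (@cvgN R R^o); exact: v1_cont.
- by move=> y; apply: (@cvgN R R^o); exact: v2_cont.
Qed.

Lemma pauli_entry_le y i j : `|pauli_entry y i j| <= (pauli_radius y)%:C.
Proof.
rewrite normc_def lecR /pauli_radius ler_sqrt; last first.
  by rewrite !addr_ge0 ?sqr_ge0.
move: (sqr_ge0 (v0 y)) (sqr_ge0 (v1 y)) (sqr_ge0 (v2 y)) => h0 h1 h2.
by case: i => [|[|i]] /=; case: j => [|[|j]] /=; rewrite ?sqrrN ?expr0n/=; lra.
Qed.

(* By the convention [0^-1 = 0] it vanishes where [pauli_radius] does. *)
Definition pauli y : 'M[R[i]]_n.+2 :=
  \matrix_(i, j) (((pauli_radius y)^-1)%:C * pauli_entry y i j).

Definition corner : 'M[R[i]]_n.+2 := \matrix_(i, j) ((i == j) && (i < 2)%N)%:R.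

Lemma sum_pauliE (m : nat -> R[i]) : (forall k, m k.+2 = 0) ->
  \sum_(k < n.+2) m k = m 0%N + m 1%N.
Proof.
by move=> m0; rewrite !big_ord_recl big1 ?addr0// => k _; rewrite /= /bump /= !add1n m0.
Qed.

Lemma pauli_sqr y : pauli_radius y != 0 -> pauli y *m pauli y = corner.
Proof.
move=> r0; apply/matrixP => i j; rewrite !mxE.
under eq_bigr do rewrite !mxE.
rewrite (@sum_pauliE (fun k => ((pauli_radius y)^-1)%:C * pauli_entry y i k *
  (((pauli_radius y)^-1)%:C * pauli_entry y k j))); last first.
  by move=> k; case: (nat_of_ord i) => [|[|?]] /=; rewrite mulr0 mul0r.
have -> (a b c d e : R[i]) : a * b * (a * c) + a * d * (a * e) = a ^+ 2 * (b * c + d * e) by ring.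
have r2 := pauli_radius_sqr y.
have r20 : v0 y ^+ 2 + v1 y ^+ 2 + v2 y ^+ 2 != 0 by rewrite -r2 sqrf_eq0.
rewrite -rmorphXn /= exprVn r2 -(inj_eq val_inj) /=.
case: (nat_of_ord i) (nat_of_ord j) => [|[|i']] [|[|j']] /=; rewrite ?eqSS /=;
  simpc; rewrite ?mulr0 ?mul0r ?addr0//;
  apply/eqP; rewrite eq_complex /=; apply/andP; split; apply/eqP;
  by rewrite ?andbF//; field.
Qed.

Lemma corner_pauli y : corner *m pauli y = pauli y.
Proof.
apply/matrixP => i j; rewrite !mxE (bigD1 i) //= big1 => [|k ki].
  rewrite !mxE eqxx /= addr0.
  by case: (nat_of_ord i) => [|[|?]] /=; rewrite ?mul1r ?mul0r ?mulr0.
by rewrite !mxE eq_sym (negPf ki) mul0r.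
Qed.

Lemma pauli_corner y : pauli y *m corner = pauli y.
Proof.
apply/matrixP => i j; rewrite !mxE (bigD1 j) //= big1 => [|k kj].
  rewrite !mxE eqxx /= addr0.
  case: (nat_of_ord i) => [|[|?]] /=; case: (nat_of_ord j) => [|[|?]] /=;
  by rewrite ?mulr1 ?mul0r ?mulr0.
by rewrite !mxE (negPf kj) mulr0.
Qed.

Lemma corner_sqr : corner *m corner = corner.
Proof.
apply/matrixP => i j; rewrite !mxE (bigD1 i) //= big1 => [|k ki].
  rewrite !mxE eqxx /= addr0.
  by case: (i < 2)%N; rewrite ?andbT ?andbF ?mul1r ?mul0r.
by rewrite !mxE eq_sym (negPf ki) mul0r.
Qed.

Lemma pauli_adjoint y : adjoint (pauli y) = pauli y.
Proof.
apply/matrixP => i j; rewrite !mxE rmorphM /= oppr0; congr (_ * _).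
case: (nat_of_ord i) => [|[|?]] /=; case: (nat_of_ord j) => [|[|?]] /=;
  by rewrite ?oppr0 ?opprK.
Qed.

Lemma corner_adjoint : adjoint corner = corner.
Proof.
apply/matrixP => i j; rewrite !mxE conjc_nat eq_sym.
by have [->|//] := eqVneq i j.
Qed.

(** Where the radius is nonzero, [pauli] has the eigenvalues 1 and -1 on the corner, so applying
    [g \o gamma] to [v.sigma] there amounts to [even_part] times [corner] plus [odd_part] times
    [pauli]. *)
Definition even_part (g : X -> R[i]) y :=
  (g (gamma (pauli_radius y)) + g (gamma (- pauli_radius y))) / 2.
Definition odd_part (g : X -> R[i]) y :=
  (g (gamma (pauli_radius y)) - g (gamma (- pauli_radius y))) / 2.

Definition pauli_mx (g : X -> R[i]) y : 'M[R[i]]_n.+2 :=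
  even_part g y *: corner + odd_part g y *: pauli y
    + g (gamma 0) *: (1%:M - corner).

Lemma odd_part0 g y : pauli_radius y = 0 -> odd_part g y = 0.
Proof. by move=> r0; rewrite /odd_part r0 oppr0 subrr mul0r. Qed.

Lemma pauli_mxM (g h : X -> R[i]) y :
  pauli_mx (fun x => g x * h x) y = pauli_mx g y *m pauli_mx h y.
Proof.
rewrite /pauli_mx.
have eM : even_part (fun x => g x * h x) y =
  even_part g y * even_part h y + odd_part g y * odd_part h y.
  by rewrite /even_part /odd_part; field.
have oM : odd_part (fun x => g x * h x) y =
  even_part g y * odd_part h y + odd_part g y * even_part h y.
  by rewrite /even_part /odd_part; field.
(* Where the radius vanishes [pauli] is zero rather than an involution of the corner, but the odd
   parts vanish as well. Hence the weighted hypothesis in [corner_calculus]. *)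
have UU : (odd_part g y * odd_part h y) *: (pauli y *m pauli y) =
    (odd_part g y * odd_part h y) *: corner.
  have [r0|r0] := eqVneq (pauli_radius y) 0; first by rewrite odd_part0// mul0r !scale0r.
  by rewrite pauli_sqr.
by rewrite eM oM [RHS]corner_calculus// ?corner_sqr ?corner_pauli ?pauli_corner.
Qed.

Lemma odd_part_continuous (g : X -> R[i]) : continuous g -> continuous (odd_part g).
Proof.
move=> cg; apply: continuousCM; last exact: cst_continuous.
have cr : continuous (fun y => g (gamma (pauli_radius y))).
  exact: continuous_compose cg (continuous_compose gamma_cont pauli_radius_continuous).
have cr' : continuous (fun y => g (gamma (- pauli_radius y))).
  apply: (continuous_compose cg (continuous_compose gamma_cont _)).
  by move=> y; apply: (@cvgN R R^o); exact: pauli_radius_continuous.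
by move=> y; apply: cvgB; [exact: cr|exact: cr'].
Qed.

Lemma even_part_continuous (g : X -> R[i]) : continuous g -> continuous (even_part g).
Proof.
move=> cg; apply: continuousCM; last exact: cst_continuous.
have cr : continuous (fun y => g (gamma (pauli_radius y))).
  exact: continuous_compose cg (continuous_compose gamma_cont pauli_radius_continuous).
have cr' : continuous (fun y => g (gamma (- pauli_radius y))).
  apply: (continuous_compose cg (continuous_compose gamma_cont _)).
  by move=> y; apply: (@cvgN R R^o); exact: pauli_radius_continuous.
exact: continuousCD cr cr'.
Qed.

(** [pauli] may be discontinuous at the zeros of the radius, but its entries have modulus at most 1
    and the odd part tends to 0 there. *)
Lemma odd_part_pauli_continuous (g : X -> R[i]) i j : continuous g ->
  continuous (fun y => odd_part g y * pauli y i j).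
Proof.
move=> cg y.
have co := odd_part_continuous cg.
have cp : continuous (fun y => pauli_entry y i j) by exact: pauli_entry_continuous.
have [r0|r0] := eqVneq (pauli_radius y) 0.
  have le z : `|odd_part g z * pauli z i j| <= `|odd_part g z|.
    rewrite normrM ler_piMr// mxE normrM.
    have [->|rz] := eqVneq (pauli_radius z) 0; first by rewrite invr0 normr0 mul0r ler01.
    have rz0 : 0 < pauli_radius z by rewrite lt_neqAle eq_sym rz sqrtr_ge0.
    have -> : `|(pauli_radius z)^-1%:C| = ((pauli_radius z)^-1)%:C.
      by rewrite ger0_norm// ler0c invr_ge0 ltW.
    apply: le_trans (ler_wpM2l _ (pauli_entry_le z i j)) _.
      by rewrite ler0c invr_ge0 ltW.
    by rewrite -rmorphM mulVf// rmorph1.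
  rewrite /continuous_at odd_part0// mul0r.
  apply: (@cvgrPdist_lt _ R[i] _ (nbhs y) (nbhs_filter y) _ _).2 => e e0.
  have := (@cvgrPdist_lt _ R[i] _ (nbhs y) (nbhs_filter y) _ _).1 (co y) e e0.
  by apply: filterS => z; rewrite odd_part0// !sub0r !normrN; exact: le_lt_trans.
rewrite /continuous_at.
under eq_fun do rewrite mxE.
rewrite mxE; apply: cvgM; first exact: co.
apply: cvgM; last exact: cp.
have h : continuous_at y (fun z => (pauli_radius z)^-1 : R).
  exact: (continuous_comp (@pauli_radius_continuous y) (inv_continuous r0)).
exact: (continuous_comp h (@real_complex_continuous R _)).
Qed.

Lemma pauli_mx_continuous (g : X -> R[i]) : continuous g ->
  continuous (pauli_mx g).
Proof.
move=> cg; apply: mx_continuousP => i j.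
rewrite (_ : (fun _ => _) = fun y => even_part g y * corner i j
    + odd_part g y * pauli y i j
    + g (gamma 0) * (1%:M - corner : 'M[R[i]]_n.+2) i j); last first.
  by apply/funext => y; rewrite /pauli_mx !mxE.
have c0 : continuous (fun _ : Y => g (gamma 0) * (1%:M - corner : 'M[R[i]]_n.+2) i j).
  exact: cst_continuous.
have c1 : continuous (fun _ : Y => corner i j) by exact: cst_continuous.
have c2 := continuousCM (even_part_continuous cg) c1.
have c3 : continuous (fun y => odd_part g y * pauli y i j).
  exact: odd_part_pauli_continuous.
exact: (continuousCD (continuousCD c2 c3) c0).
Qed.

Lemma pauli_mxD (f g : X -> R[i]) y :
  pauli_mx (fun x => f x + g x) y = pauli_mx f y + pauli_mx g y.
Proof.
rewrite /pauli_mx.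
have -> : even_part (fun x => f x + g x) y = even_part f y + even_part g y.
  by rewrite /even_part -mulrDl addrACA.
have -> : odd_part (fun x => f x + g x) y = odd_part f y + odd_part g y.
  by rewrite /odd_part -mulrDl opprD addrACA.
by rewrite !scalerDl (addrACA (even_part f y *: _)) [LHS]addrACA.
Qed.

Lemma pauli_mxZ (c : R[i]) (f : X -> R[i]) y :
  pauli_mx (fun x => c * f x) y = c *: pauli_mx f y.
Proof.
rewrite /pauli_mx.
have -> : even_part (fun x => c * f x) y = c * even_part f y.
  by rewrite /even_part mulrA mulrDr.
have -> : odd_part (fun x => c * f x) y = c * odd_part f y.
  by rewrite /odd_part mulrA mulrBr.
by rewrite !scalerDr !scalerA.
Qed.

Lemma pauli_mxJ (f : X -> R[i]) y :
  pauli_mx (fun x => (f x)^*) y = adjoint (pauli_mx f y).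
Proof.
have c2 : (2^-1 : R[i]) = (2^-1 : R)%:C by rewrite fmorphV rmorph_nat.
have eD : even_part (fun x => (f x)^*) y = (even_part f y)^*.
  rewrite /even_part; case: (f _) (f _) => a1 a2 [b1 b2]; rewrite c2; apply/eqP.
  by rewrite eq_complex /=; apply/andP; split; apply/eqP; ring.
have eB : odd_part (fun x => (f x)^*) y = (odd_part f y)^*.
  rewrite /odd_part; case: (f _) (f _) => a1 a2 [b1 b2]; rewrite c2; apply/eqP.
  by rewrite eq_complex /=; apply/andP; split; apply/eqP; ring.
rewrite /pauli_mx !adjointD !adjointZ adjointB.
by rewrite adjoint1 pauli_adjoint corner_adjoint eD eB.
Qed.

Lemma pauli_mx1 y : pauli_mx (fun=> 1) y = 1%:M.
Proof.
rewrite /pauli_mx /even_part /odd_part subrr mul0r scale0r addr0.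
rewrite (_ : (1 + 1) / 2 = 1) ?scale1r; last by field.
by rewrite addrC subrK.
Qed.

Definition pauli_hom (g : cont R X) : cont_mx R Y n.+2 :=
  mkcts (pauli_mx_continuous (@cts_fun _ _ g)).

Lemma pauli_hom_unital_star_hom : unital_star_hom pauli_hom.
Proof.
split.
- by move=> f g y; exact (pauli_mxD f g y).
- by move=> c f y; exact (pauli_mxZ c f y).
- by move=> f g y; exact (pauli_mxM f g y).
- by move=> f y; exact (pauli_mxJ f y).
- by move=> y; exact (pauli_mx1 y).
Qed.

End PauliHomomorphism.

(** * Approximate eigenvectors of Pauli matrices *)

Section Estimates.
Variable R : realType.

Definition sqmod (z : R[i]) : R := Re z ^+ 2 + Im z ^+ 2.
Definition sqvec n (v : 'cV[R[i]]_n) : R := \sum_(i < n) sqmod (v i 0).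

Lemma sqmod_ge0 z : 0 <= sqmod z.
Proof. by rewrite addr_ge0 ?sqr_ge0. Qed.

Lemma sqmod_eq0 z : (sqmod z == 0) = (z == 0).
Proof.
by case: z => a b; rewrite /sqmod /= paddr_eq0 ?sqr_ge0// !sqrf_eq0 eq_complex.
Qed.

Lemma sqvec_ge0 n (v : 'cV[R[i]]_n) : 0 <= sqvec v.
Proof. by apply: sumr_ge0 => i _; exact: sqmod_ge0. Qed.

Lemma sqvec_eq0 n (v : 'cV[R[i]]_n) : sqvec v = 0 -> v = 0.
Proof.
move=> v0; apply/colP => i; rewrite mxE; apply/eqP; rewrite -sqmod_eq0.
move/eqP: v0; rewrite psumr_eq0 => [/allP/(_ i)|j _]; last exact: sqmod_ge0.
by rewrite mem_index_enum => /(_ isT).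
Qed.

Lemma sqmodZ (c : R) z : sqmod (c%:C * z) = c ^+ 2 * sqmod z.
Proof. by case: z => a b; rewrite /sqmod /= !mul0r subr0 addr0 !exprMn -mulrDr. Qed.

Lemma sqvecZ n (c : R) (v : 'cV[R[i]]_n) : sqvec (c%:C *: v) = c ^+ 2 * sqvec v.
Proof.
by rewrite /sqvec mulr_sumr; apply: eq_bigr => i _; rewrite mxE sqmodZ.
Qed.

Lemma vec_normE n (v : 'cV[R[i]]_n) : vec_norm v = Num.sqrt (sqvec v).
Proof.
rewrite /vec_norm /sqvec; congr Num.sqrt; apply: eq_bigr => i _.
case: (v i 0) => a b; rewrite /sqmod /= sqr_sqrtr//.
by rewrite addr_ge0 ?sqr_ge0.
Qed.

Lemma sup_norm_lt (Y : topologicalType) n (F : Y -> 'M[R[i]]_n) (eps : R) :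
  0 < eps -> (sup_norm F < eps%:E)%E ->
  forall y v, sqvec (F y *m v) <= eps ^+ 2 * sqvec v.
Proof.
move=> e0 Fe y v.
have bnd u : vec_norm u <= 1 -> vec_norm (F y *m u) <= eps.
  move=> u1; rewrite -lee_fin; apply/ltW; apply: le_lt_trans Fe.
  apply: (@le_trans _ _ (op_norm (F y))); apply: ereal_sup_ubound.
    by exists u.
  by exists y.
have [v0|v0] := eqVneq (sqvec v) 0.
  have z0 : sqvec (0 : 'cV[R[i]]_n) = 0.
    by rewrite /sqvec big1// => i _; rewrite mxE /sqmod /= expr0n addr0.
  by rewrite v0 (sqvec_eq0 v0) mulmx0 z0 mulr0.
have vp : 0 < sqvec v by rewrite lt_neqAle eq_sym v0 sqvec_ge0.
have s0 : 0 < Num.sqrt (sqvec v) by rewrite sqrtr_gt0.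
have := bnd ((Num.sqrt (sqvec v))^-1%:C *: v).
rewrite !vec_normE -scalemxAr !sqvecZ exprVn sqr_sqrtr ?sqvec_ge0// mulVf//.
rewrite sqrtr1 lexx => /(_ isT) h.
have : Num.sqrt ((sqvec v)^-1 * sqvec (F y *m v)) ^+ 2 <= eps ^+ 2.
  by rewrite ler_pXn2r// nnegrE ?sqrtr_ge0// ltW.
rewrite sqr_sqrtr; last by rewrite mulr_ge0 ?invr_ge0 ?sqvec_ge0.
by rewrite mulrC ler_pdivrMr.
Qed.

(** The hermitian form of the matrix [(x, y, t).sigma] evaluated at the vector [(a, b)]. *)
Definition bloch (x y t : R) (a b : R[i]) : R :=
  t * (sqmod a - sqmod b) + 2 * Re ((x +i* y) * (a * b^*)).

(** Expansion of the squared length of [m sigma w - c w] for [w = (a, b)]: the hermitian involution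
    [sigma = (x, y, t).sigma] preserves lengths, and the cross term is the form [bloch]. *)
Lemma pauli_residual x y t (m c : R) (a b : R[i]) : x ^+ 2 + y ^+ 2 + t ^+ 2 = 1 ->
  sqmod (m%:C * (t%:C * a + (x -i* y) * b) - c%:C * a) +
  sqmod (m%:C * ((x +i* y) * a + (- t)%:C * b) - c%:C * b) =
  (m ^+ 2 + c ^+ 2) * (sqmod a + sqmod b) - 2 * m * c * bloch x y t a b.
Proof.
case: a b => a1 a2 [b1 b2] xyt; rewrite /bloch /sqmod /=.
set A := a1 ^+ 2 + a2 ^+ 2; set B := b1 ^+ 2 + b2 ^+ 2.
transitivity ((m ^+ 2 * (x ^+ 2 + y ^+ 2 + t ^+ 2) + c ^+ 2) * (A + B)
  - 2 * m * c * (t * (A - B) + 2 * (x * (a1 * b1 - a2 * - b2) - y * (a1 * - b2 + a2 * b1)))).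
  by rewrite /A /B; ring.
by rewrite xyt mulr1.
Qed.
(** For [m = c = 1] the residual is twice the difference of the two sides, and it is a sum of
    squares. *)
Lemma bloch_le x y t a b : x ^+ 2 + y ^+ 2 + t ^+ 2 = 1 ->
  bloch x y t a b <= sqmod a + sqmod b.
Proof.
move=> xyt; have := pauli_residual 1 1 a b xyt.
have := addr_ge0 (sqmod_ge0 (1%:C * (t%:C * a + (x -i* y) * b) - 1%:C * a))
  (sqmod_ge0 (1%:C * ((x +i* y) * a + (- t)%:C * b) - 1%:C * b)).
by move=> /[swap] ->; lra.
Qed.

(* With [(x, y, t)] as a point of the Bloch sphere, the eigenvectors of
   [m (x, y, t).sigma] for the eigenvalue [m] have positive [bloch] value, and this
   persists for approximate eigenvectors. *)
Lemma bloch_gt0 x y t m c a b S eps : x ^+ 2 + y ^+ 2 + t ^+ 2 = 1 ->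
  0 < eps -> eps < m / 2 -> m / 2 < c -> 0 <= S -> 0 < sqmod a + sqmod b + S ->
  sqmod (m%:C * (t%:C * a + (x -i* y) * b) - c%:C * a) +
  sqmod (m%:C * ((x +i* y) * a + (- t)%:C * b) - c%:C * b) + c ^+ 2 * S
    <= eps ^+ 2 * (sqmod a + sqmod b + S) ->
  0 < bloch x y t a b.
Proof.
move=> xyt e0 em mc S0 p0; rewrite pauli_residual// ltNge => le; apply/negP => Q0.
have A0 := addr_ge0 (sqmod_ge0 a) (sqmod_ge0 b).
move: (bloch x y t a b) Q0 le => Q Q0 le.
move: (sqmod a + sqmod b) A0 p0 le => A A0 p0 le.
(* If [Q <= 0], the residual is at least [(m / 2) ^ 2 * (A + S)], which exceeds the allowed
   [eps ^ 2 * (A + S)]. *)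
have h1 : 0 <= - (2 * m * c * Q).
  by rewrite -mulrN mulr_ge0 ?oppr_ge0// mulr_ge0 ?mulr_ge0//; lra.
have h2 : eps ^+ 2 < (m / 2) ^+ 2 by rewrite ltrXn2r// ?nnegrE; lra.
have h3 : (m / 2) ^+ 2 < c ^+ 2 by rewrite ltrXn2r// ?nnegrE; lra.
have h4 : eps ^+ 2 * (A + S) < (m / 2) ^+ 2 * (A + S) by rewrite ltr_pM2r.
have h5 : (m / 2) ^+ 2 * S <= c ^+ 2 * S by rewrite ler_wpM2r// ltW.
have h6 : (m / 2) ^+ 2 * A <= (m ^+ 2 + c ^+ 2) * A.
  by rewrite ler_wpM2r//; move: (sqr_ge0 m) (sqr_ge0 c); lra.
by move: le h1 h4 h5 h6; rewrite !mulrDr; lra.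
Qed.

(** The number [m / 2] has distance at least [m / 2] from each of the eigenvalues [m], [-m] and 0,
    so no residual is relatively smaller than that. This prevents an approximate eigenvalue from
    crossing [m / 2]. *)
Lemma no_half_eigenvalue x y t m a b S eps : x ^+ 2 + y ^+ 2 + t ^+ 2 = 1 ->
  0 < eps -> eps < m / 2 -> 0 <= S -> 0 < sqmod a + sqmod b + S ->
  sqmod (m%:C * (t%:C * a + (x -i* y) * b) - (m / 2)%:C * a) +
  sqmod (m%:C * ((x +i* y) * a + (- t)%:C * b) - (m / 2)%:C * b) + (m / 2) ^+ 2 * S
    <= eps ^+ 2 * (sqmod a + sqmod b + S) ->
  False.
Proof.
move=> xyt e0 em S0 p0; rewrite pauli_residual// => le.
have := bloch_le a b xyt.
move: (bloch x y t a b) le => Q le.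
have A0 := addr_ge0 (sqmod_ge0 a) (sqmod_ge0 b).
move: (sqmod a + sqmod b) A0 p0 le => A A0 p0 le QA.
have h2 : eps ^+ 2 < (m / 2) ^+ 2 by rewrite ltrXn2r// ?nnegrE; lra.
have h4 : eps ^+ 2 * (A + S) < (m / 2) ^+ 2 * (A + S) by rewrite ltr_pM2r.
have h5 : m ^+ 2 * Q <= m ^+ 2 * A by rewrite ler_wpM2l// sqr_ge0.
have e1 : (m / 2) ^+ 2 = m ^+ 2 / 4 by field.
have e2 : 2 * m * (m / 2) * Q = m ^+ 2 * Q by field.
by move: le h4 h5; rewrite e2 e1 !mulrDr !mulrDl; lra.
Qed.
End Estimates.

(** * The tautological line bundle over the sphere *)

Section Loops.
Variable R : realType.

(* [t |-> loop t ^ 2] runs once around the origin as [t] runs over [-1, 1],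
   while [loop] itself is anti-periodic. *)
Definition loop (t : R) : R[i] := (1 - t ^+ 2) +i* t.

Lemma loop_continuous : continuous loop.
Proof.
apply: continuous_complexP => /=.
  rewrite (_ : (fun _ => _) = fun t : R => 1 - t * t); last first.
    by apply/funext => t; rewrite /= expr2.
  apply: continuousRB; first exact: cst_continuous.
  by apply: continuousRM => t; exact: cvg_id.
by move=> t; exact: cvg_id.
Qed.

Lemma loop_neq0 t : loop t != 0.
Proof.
rewrite eq_complex /= negb_and; have [t0|t0] := eqVneq t 0.
  by rewrite t0 expr0n subr0 oner_eq0.
by apply/orP; right.
Qed.

Lemma loop1 : loop 1 = - loop (-1).
Proof. by apply/eqP; rewrite eq_complex /= sqrrN expr1n subrr oppr0 opprK !eqxx. Qed.

Lemma has_square_root_cst (c : R[i]) : has_square_root (fun=> c).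
Proof.
exists (fun=> sqrtc c); split => // [|t _]; first exact: cst_continuous.
by exists 1 => //; rewrite sqr_sqrtc rmorph1 mul1r.
Qed.

Lemma has_square_root_conj (g : R -> R[i]) :
  has_square_root g -> has_square_root (fun t => (g t)^*).
Proof.
move=> [h [ch eh hg]]; exists (fun t => (h t)^*); split; first exact: continuous_conj.
  by rewrite eh.
move=> t /hg[c c0 e]; exists c => //; rewrite -rmorphXn /= e.
by case: (g t) => a b; apply/eqP; rewrite eq_complex /=; apply/andP; split; apply/eqP; ring.
Qed.

Lemma has_square_rootM (g1 g2 : R -> R[i]) : has_square_root g1 ->
  has_square_root g2 -> has_square_root (fun t => g1 t * g2 t).
Proof.
move=> [h1 [ch1 eh1 hg1]] [h2 [ch2 eh2 hg2]]; exists (fun t => h1 t * h2 t); split.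
- exact: continuousCM ch1 ch2.
- by rewrite eh1 eh2.
- move=> t t1; have [c1 c10 e1] := hg1 t t1; have [c2 c20 e2] := hg2 t t1.
  by exists (c1 * c2); [exact: mulr_gt0|rewrite exprMn e1 e2 rmorphM /= mulrACA].
Qed.

(** A surface around the origin parametrized by the square [-1, 1] x [-1, 1]: [k.1] is the height,
    [k.2] runs around the horizontal loop. The edges [k.1 = 1] and [k.1 = -1] collapse to the poles,
    the other two edges are glued. Points are not of unit length; only their direction matters. *)
Definition sphere_point (k : R * R) : R * R * R :=
  ((1 - `|k.1|) * Re (loop k.2 ^+ 2), (1 - `|k.1|) * Im (loop k.2 ^+ 2), k.1).

Definition ray (s : R) (p : R * R * R) : R * R * R := (s * p.1.1, s * p.1.2, s * p.2).

Lemma continuous_ReIm_loop2 :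
  continuous (fun t => Re (loop t ^+ 2)) /\ continuous (fun t => Im (loop t ^+ 2)).
Proof.
have c2 : continuous (fun t => loop t ^+ 2).
  rewrite (_ : (fun _ => _) = fun t : R => loop t * loop t).
    exact: continuousCM loop_continuous loop_continuous.
  by apply/funext => t; rewrite expr2.
split; first exact: continuous_Re.
exact: continuous_compose (@Im_continuous R) c2.
Qed.

Lemma sphere_point_continuous : continuous sphere_point.
Proof.
have c1 : continuous (fun k : R * R => 1 - `|k.1|).
  apply: continuousRB; first exact: cst_continuous.
  exact: continuous_compose (@norm_continuous R R^o) (@continuous_fst _ _).
have [cr ci] := continuous_ReIm_loop2.
apply: continuous_pair; last exact: continuous_fst.
apply: continuous_pair; apply: (continuousRM c1).
  exact: continuous_compose cr (@continuous_snd _ _).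
exact: continuous_compose ci (@continuous_snd _ _).
Qed.

Lemma ray_sphere_point_continuous :
  continuous (fun q : R * (R * R) => ray q.1 (sphere_point q.2)).
Proof.
have cs := continuous_compose sphere_point_continuous (@continuous_snd R (R * R)%type).
have c0 : continuous (fun q : R * (R * R) => (sphere_point q.2).1).
  exact: continuous_compose (@continuous_fst _ _) cs.
have c1 := continuous_compose (@continuous_fst _ _) c0.
have c2 := continuous_compose (@continuous_snd _ _) c0.
have c3 : continuous (fun q : R * (R * R) => (sphere_point q.2).2).
  exact: continuous_compose (@continuous_snd _ _) cs.
have cf := @continuous_fst R (R * R)%type.
exact: (continuous_pair (continuous_pair (continuousRM cf c1) (continuousRM cf c2))
  (continuousRM cf c3)).
Qed.

Lemma ray1 p : ray 1 p = p.
Proof. by case: p => [[a b] c]; rewrite /ray /= !mul1r. Qed.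

Lemma ray0 p : ray 0 p = (0, 0, 0).
Proof. by case: p => [[a b] c]; rewrite /ray /= !mul0r. Qed.

Lemma sphere_point1 t : sphere_point (1, t) = (0, 0, 1).
Proof. by rewrite /sphere_point /= normr1 subrr !mul0r. Qed.

Lemma sphere_pointN1 t : sphere_point (-1, t) = (0, 0, -1).
Proof. by rewrite /sphere_point /= normrN normr1 subrr !mul0r. Qed.

Lemma sphere_point_period s : sphere_point (s, 1) = sphere_point (s, -1).
Proof. by rewrite /sphere_point; cbn [fst snd]; rewrite loop1 sqrrN. Qed.

Lemma sphere_point_neq0 k :
  0 < (sphere_point k).1.1 ^+ 2 + (sphere_point k).1.2 ^+ 2 + (sphere_point k).2 ^+ 2.
Proof.
case: k => s t; rewrite /sphere_point; cbn [fst snd].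
have := loop_neq0 t; rewrite -sqrf_eq0 -sqmod_eq0; move: (loop t ^+ 2) => z z0.
have zp : 0 < sqmod z by rewrite lt_neqAle eq_sym z0 sqmod_ge0.
rewrite !exprMn -mulrDr -/(sqmod z).
have [->|s0] := eqVneq s 0.
  by rewrite normr0 subr0 expr1n mul1r expr0n addr0.
have s2 : 0 < s ^+ 2 by rewrite lt_neqAle eq_sym sqrf_eq0 s0 sqr_ge0.
by rewrite ltr_wpDl// mulr_ge0 ?sqr_ge0// ltW.
Qed.

Lemma bloch0l x y t (b : R[i]) : bloch x y t 0 b = - (t * sqmod b).
Proof. by case: b => b1 b2; rewrite /bloch /sqmod /=; ring. Qed.

Lemma bloch0r x y t (a : R[i]) : bloch x y t a 0 = t * sqmod a.
Proof. by case: a => a1 a2; rewrite /bloch /sqmod /=; ring. Qed.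

(* The two halves of the sphere are the regions where the first, respectively the
   second, coordinate of the vector field cannot vanish; pulling both coordinates
   back from the poles to the equator makes [loop ^ 2] a square. *)
Lemma no_bloch_section (a b : R * R -> R[i]) :
  continuous a -> continuous b ->
  (forall k k', sphere_point k = sphere_point k' -> a k = a k' /\ b k = b k') ->
  (forall k, -1 <= k.1 <= 1 -> -1 <= k.2 <= 1 ->
    0 < bloch (sphere_point k).1.1 (sphere_point k).1.2 (sphere_point k).2 (a k) (b k)) ->
  False.
Proof.
move=> ca cb eab ab0.
have cpair (u : R -> R) : continuous u ->
    continuous (fun p : R * R => (u p.1, p.2)).
  move=> cu; apply: continuous_pair; last exact: continuous_snd.
  exact: continuous_compose cu (@continuous_fst _ _).
have c0 : continuous (fun t : R => (0 : R, t)).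
  by apply: continuous_pair => t; [exact: cst_continuous|exact: cvg_id].
have sa : has_square_root (fun t => a (0, t)).
  (* The homotopy descends from the pole, where [a] is constant, to the equator. At a height
     [1 - s >= 0] a zero of [a] would make [bloch] nonpositive. *)
  pose G (s t : R) := a (1 - s, t).
  rewrite (_ : (fun _ => _) = G 1); last by apply/funext => t; rewrite /G subrr.
  apply: has_square_root_homotopy.
  - apply: (continuous_compose ca); apply: (cpair (fun s => 1 - s)).
    by apply: continuousRB => t; [exact: cst_continuous|exact: cvg_id].
  - by move=> s; exact: (eab _ _ (sphere_point_period _)).1.
  - move=> s t s1 t1; apply/eqP => a0.
    have s1' : -1 <= 1 - s <= 1 by move: s1; lra.
    have := ab0 (1 - s, t) s1' t1.
    rewrite -/(G s t) a0 bloch0l oppr_gt0 /=.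
    by rewrite ltNge mulr_ge0 ?sqmod_ge0//; move: s1; lra.
  - rewrite (_ : G 0 = fun=> a (1, 0)); first exact: has_square_root_cst.
    apply/funext => t; rewrite /G subr0.
    by apply: (eab _ _ _).1; rewrite !sphere_point1.
have sb : has_square_root (fun t => b (0, t)).
  pose G (s t : R) := b (s - 1, t).
  rewrite (_ : (fun _ => _) = G 1); last by apply/funext => t; rewrite /G subrr.
  apply: has_square_root_homotopy.
  - apply: (continuous_compose cb); apply: (cpair (fun s => s - 1)).
    by apply: continuousRB => t; [exact: cvg_id|exact: cst_continuous].
  - by move=> s; exact: (eab _ _ (sphere_point_period _)).2.
  - move=> s t s1 t1; apply/eqP => b0.
    have s1' : -1 <= s - 1 <= 1 by move: s1; lra.
    have := ab0 (s - 1, t) s1' t1.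
    rewrite -/(G s t) b0 bloch0r /=.
    by rewrite ltNge mulr_le0_ge0 ?sqmod_ge0//; move: s1; lra.
  - rewrite (_ : G 0 = fun=> b (-1, 0)); first exact: has_square_root_cst.
    apply/funext => t; rewrite /G sub0r.
    by apply: (eab _ _ _).2; rewrite !sphere_pointN1.
have ca0 : continuous (fun t : R => a (0, t)) := continuous_compose ca c0.
have cb0 : continuous (fun t : R => b (0, t)) := continuous_compose cb c0.
apply: (@no_square_root R loop loop_continuous loop1) => [t _|]; first exact: loop_neq0.
(* On the equator positivity of [bloch] says that [loop ^ 2] times the conjugate of [a^* * b] has
   positive real part, so [loop ^ 2] inherits a square root from [a^* * b]. *)
apply: has_square_root_step (has_square_rootM (has_square_root_conj sa) sb).
- exact: continuousCM (continuous_conj ca0) cb0.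
- rewrite (_ : (fun _ => _) = fun t : R => loop t * loop t).
    exact: continuousCM loop_continuous loop_continuous.
  by apply/funext => t; rewrite expr2.
- by have [-> ->] := eab _ _ (sphere_point_period 0).
- by rewrite loop1 sqrrN.
- move=> t t1; have z1 : -1 <= (0 : R) <= 1 by lra.
  have := ab0 (0, t) z1 t1.
  rewrite /bloch /sphere_point; cbn [fst snd].
  rewrite normr0 subr0 !mul1r mul0r add0r pmulr_rgt0//.
  case: (loop t ^+ 2) (a (0, t)) (b (0, t)) => x y [a1 a2] [b1 b2] /=.
  by congr (_ < _); ring.
Qed.
End Loops.

(** * The obstruction to approximate diagonalization *)

Lemma projection_diag (R : realType) n (p : 'M[R[i]]_n) i :
  p *m p = p -> adjoint p = p -> Re (p i i) = \sum_j sqmod (p i j).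
Proof.
move=> pp pa; rewrite -{1}pp mxE (raddf_sum (@complex.Re R : Rcomplex R -> R)).
apply: eq_bigr => j _; rewrite -{2}pa !mxE /sqmod.
by case: (p i j) => a b /=; rewrite mulrN opprK !expr2.
Qed.

(** The sum [P] is again a projection, so [Re (P i i)], being the squared length of a row, is at
    least its own square. *)
Lemma projections_diag_le1 (R : realType) n (I : finType) (p : I -> 'M[R[i]]_n) i :
  (forall j, p j *m p j = p j) -> (forall j, adjoint (p j) = p j) ->
  (forall j k, j != k -> p j *m p k = 0) -> \sum_j Re (p j i i) <= 1.
Proof.
move=> pp pa porth; pose P := \sum_j p j.
have PP : P *m P = P.
  rewrite /P mulmx_suml; apply: eq_bigr => j _; rewrite mulmx_sumr (bigD1 j) //= pp.
  by rewrite big1 ?addr0// => k kj; apply: porth; rewrite eq_sym.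
have PA : adjoint P = P.
  rewrite /P /adjoint map_mx_sum linear_sum /=; apply: eq_bigr => j _; exact: pa.
have -> : \sum_j Re (p j i i) = Re (P i i).
  by rewrite /P summxE (raddf_sum (@complex.Re R : Rcomplex R -> R)).
have := projection_diag i PP PA; rewrite (bigD1 i) //= /sqmod => e.
have : 0 <= \sum_(j | j != i) sqmod (P i j) by apply: sumr_ge0 => j _; exact: sqmod_ge0.
move: e; rewrite /sqmod; set s := \sum_(_ | _) _ => e s0.
have := sqr_ge0 (Im (P i i)); move: (Re (P i i)) (Im (P i i)) e => x z e z0.
nra.
Qed.

Lemma pauli_residualE (R : realType) (Y : topologicalType) n (v0 v1 v2 : Y -> R)
    (y : Y) (m c : R) (v : 'cV[R[i]]_n.+2) : pauli_radius v0 v1 v2 y != 0 ->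
  let x0 := v0 y / pauli_radius v0 v1 v2 y in
  let x1 := v1 y / pauli_radius v0 v1 v2 y in
  let x2 := v2 y / pauli_radius v0 v1 v2 y in
  let a := v 0 0 in let b := v (lift 0 0) 0 in
  sqvec ((m%:C *: pauli n v0 v1 v2 y) *m v - c%:C *: v) =
  sqmod (m%:C * (x2%:C * a + (x0 -i* x1) * b) - c%:C * a) +
  sqmod (m%:C * ((x0 +i* x1) * a + (- x2)%:C * b) - c%:C * b) +
  c ^+ 2 * \sum_(k < n) sqmod (v (lift 0 (lift 0 k)) 0).
Proof.
move=> r0 x0 x1 x2 a b; rewrite /sqvec !big_ord_recl addrA.
have row i : ((m%:C *: pauli n v0 v1 v2 y) *m v - c%:C *: v) i 0 =
   m%:C * ((pauli_radius v0 v1 v2 y)^-1)%:C *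
     (pauli_entry v0 v1 v2 y i 0 * a + pauli_entry v0 v1 v2 y i 1 * b)
   - c%:C * v i 0.
  rewrite [LHS]mxE [X in X + _]mxE !big_ord_recl big1 ?addr0 => [|k _]; last first.
    rewrite !mxE /= /bump /= !add1n.
    by case: (nat_of_ord i) => [|[|?]] /=; rewrite !(mulr0, mul0r).
  by rewrite !mxE /= /a /b; ring.
rewrite mulr_sumr; congr (_ + _ + _).
- rewrite row /= /x0 /x1 /x2 -/a; congr sqmod.
  clear row; case: a b => a1 a2 [b1 b2]; apply/eqP; rewrite eq_complex /=; apply/andP; split; apply/eqP; by ring.
- rewrite row /= /x0 /x1 /x2 -/b; congr sqmod.
  clear row; case: a b => a1 a2 [b1 b2]; apply/eqP; rewrite eq_complex /=; apply/andP; split; apply/eqP; by ring.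
- apply: eq_bigr => k _; rewrite row.
  have p0 j : pauli_entry v0 v1 v2 y (lift ord0 (lift ord0 k)) j = 0 by [].
  rewrite !p0 !mul0r addr0 mulr0 sub0r.
  by rewrite -sqmodZ /sqmod; case: (_ * _) => u w /=; rewrite !sqrrN.
Qed.

Lemma normalized_sqr (R : realType) (Y : topologicalType) (v0 v1 v2 : Y -> R) y :
  pauli_radius v0 v1 v2 y != 0 ->
  (v0 y / pauli_radius v0 v1 v2 y) ^+ 2 + (v1 y / pauli_radius v0 v1 v2 y) ^+ 2
    + (v2 y / pauli_radius v0 v1 v2 y) ^+ 2 = 1.
Proof.
move=> r0; rewrite !expr_div_n -!mulrDl -pauli_radius_sqr divff//.
by rewrite sqrf_eq0.
Qed.

Lemma blochZ (R : realType) (l x y t : R) a b :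
  bloch (l * x) (l * y) (l * t) a b = l * bloch x y t a b.
Proof. by case: a b => a1 a2 [b1 b2]; rewrite /bloch /sqmod /=; ring. Qed.

Lemma sqvec_split (R : realType) n (v : 'cV[R[i]]_n.+2) :
  sqvec v = sqmod (v 0 0) + sqmod (v (lift 0 0) 0)
    + \sum_(k < n) sqmod (v (lift 0 (lift 0 k)) 0).
Proof. by rewrite /sqvec !big_ord_recl addrA. Qed.

(** The square is star-shaped about [(1, 0)], so a change of sign would produce a zero on a segment
    from there. *)
Lemma square_sign (R : realType) (h : R * R -> R) :
  continuous h -> 0 < h (1, 0) ->
  (forall k, -1 <= k.1 <= 1 -> -1 <= k.2 <= 1 -> h k != 0) ->
  forall k, -1 <= k.1 <= 1 -> -1 <= k.2 <= 1 -> 0 < h k.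
Proof.
move=> ch h1 h0 [s t] /= s1 t1; rewrite ltNge; apply/negP => hk.
pose g u := h (1 + u * (s - 1), u * t).
have cl (c d : R) : continuous (fun u : R => c + u * d).
  apply: continuousRD; first exact: cst_continuous.
  by apply: continuousRM => u; [exact: cvg_id|exact: cst_continuous].
have cg : continuous g.
  have cp : continuous (fun u : R => (1 + u * (s - 1), u * t)).
    apply: continuous_pair; first exact: cl.
    by apply: continuousRM => u; [exact: cvg_id|exact: cst_continuous].
  exact: continuous_compose ch cp.
have g0 : g 0 = h (1, 0) by rewrite /g !mul0r addr0.
have g1 : g 1 = h (s, t) by rewrite /g !mul1r addrC subrK.
have [u] : exists2 u, u \in `[0, 1]%R & g u = 0.
  apply: IVT => //; first exact: continuous_subspaceT.
  rewrite g0 g1 ge_min le_max hk (ltW h1) orbT /=.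
  by [].
rewrite in_itv /= => /andP[u0 u1] gu.
move: s1 t1 => /andP[sa sb] /andP[ta tb].
have := h0 (1 + u * (s - 1), u * t); rewrite /= -/(g u) gu eqxx.
move=> H; suff: false by []; apply: H; apply/andP; split; nra.
Qed.

(** The function [f] detects the sign of the parameter of [gamma], and [Phi] maps R^3 to [Y] so that
    [v] at the image of [p] is a positive multiple of [p]. The surface of [sphere_point] carries the
    bundle, and the rays to its points carry the contraction that trivializes it. *)
Theorem pauli_hom_not_diagonalizable (R : realType) (X Y : topologicalType) (n : nat)
    (gamma : R -> X) (v0 v1 v2 : Y -> R) (cgamma : continuous gamma)
    (c0 : continuous v0) (c1 : continuous v1) (c2 : continuous v2)
    (f : X -> R) (Phi : R * R * R -> Y) (psi : R * R * R -> R) :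
  continuous f -> (forall s, f (gamma (- s)) = - f (gamma s)) ->
  (forall s, 0 < s -> 0 < f (gamma s)) ->
  continuous Phi -> (forall p, 0 < psi p) ->
  (forall p, v0 (Phi p) = psi p * p.1.1) ->
  (forall p, v1 (Phi p) = psi p * p.1.2) ->
  (forall p, v2 (Phi p) = psi p * p.2) ->
  ~ approximately_diagonalizable (pauli_hom n cgamma c0 c1 c2).
Proof.
move=> cf fodd fpos cPhi psi0 e0 e1 e2 diag.
have cfC : continuous (fun x => (f x)%:C) := continuous_compose (@real_complex_continuous R) cf.
pose fC : cont R X := mkcts cfC.
have fCE x : fC x = (f x)%:C by [].
pose r := pauli_radius v0 v1 v2.
pose m y := f (gamma (r y)).
(* As [f] is odd along [gamma], its even part and its value at [gamma 0] vanish. *)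
have homE y : pauli_hom n cgamma c0 c1 c2 fC y = (m y)%:C *: pauli n v0 v1 v2 y.
  rewrite [LHS]/(pauli_mx n gamma v0 v1 v2 fC y) /pauli_mx.
  have CN (a : R) : (- a)%:C = - a%:C := rmorphN (real_complex R) a.
  have -> : even_part gamma v0 v1 v2 fC y = 0.
    by rewrite /even_part !fCE fodd CN subrr mul0r.
  have -> : odd_part gamma v0 v1 v2 fC y = (m y)%:C.
    by rewrite /odd_part !fCE fodd CN opprK -/r -/(m y); field.
  have -> : fC (gamma 0) = 0.
    rewrite fCE.
    have := fodd 0; rewrite oppr0 => h; rewrite (_ : f (gamma 0) = 0) ?rmorph0//.
    lra.
  by rewrite !scale0r add0r addr0.
pose q k := Phi (sphere_point k).
have cq : continuous q := continuous_compose cPhi (@sphere_point_continuous R).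
have rq k : 0 < r (q k).
  have := sphere_point_neq0 k; rewrite /r /q; move: (sphere_point k) => pt h.
  by rewrite sqrtr_gt0 e0 e1 e2 !exprMn -!mulrDr mulr_gt0 ?exprn_gt0.
have cm : continuous (fun k => m (q k)).
  have cr : continuous (fun k => r (q k)).
    exact: (continuous_compose (pauli_radius_continuous c0 c1 c2) cq).
  exact: (continuous_compose cf (continuous_compose cgamma cr)).
pose K : set (R * R) := `[-1, 1] `*` `[-1, 1].
have KP k : K k <-> (-1 <= k.1 <= 1) /\ (-1 <= k.2 <= 1).
  by rewrite /K /setX /= !in_itv.
have cK : compact K by apply: compact_setX; exact: segment_compact.
have K1 : K (1, 0) by apply/KP => /=; split; lra.
have [k0 k0K k0min] := @compact_EVT_min _ R (fun k => m (q k)) K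
  (ex_intro _ _ K1) cK (continuous_subspaceT cm).
(* A quarter of the minimum of [m] over the square, so that [eps < m / 2] at every sphere point. *)
pose eps := m (q k0) / 4.
have mk0 : 0 < m (q k0) by exact: fpos.
have eps0 : 0 < eps by rewrite divr_gt0.
have epsm k : K k -> eps < m (q k) / 2.
  by move=> Kk; have := k0min k (mem_set Kk); rewrite /eps; lra.
have [alpha [p [pproj prank porth papp]]] := diag eps [set fC] eps0 (finite_set1 fC).
pose E y := pauli_hom n cgamma c0 c1 c2 fC y - \sum_(i < n.+2) fC (alpha i y) *: p i y.
have EP y v : sqvec (E y *m v) <= eps ^+ 2 * sqvec v.
  exact: (sup_norm_lt eps0 (papp fC erefl)).
pose beta i y := f (alpha i y).
have EE y : E y = (m y)%:C *: pauli n v0 v1 v2 y - \sum_i (beta i y)%:C *: p i y.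
  by rewrite /E homE.
have pp i y : p i y *m p i y = p i y := (pproj i y).1.
have pa i y : adjoint (p i y) = p i y := (pproj i y).2.
(* At the pole the upper left entry of the image of [f] is [m]. If every [beta i] were at most
   [m / 2], the diagonal sum would contribute at most [m / 2] to this entry, leaving an error above
   [eps]. *)
have [i bi] : exists i, m (q (1, 0)) / 2 < beta i (q (1, 0)).
  set y := q (1, 0).
  apply: contrapT => /forallNP nb.
  have {}nb i : beta i y <= m y / 2 by rewrite leNgt; apply/negP; exact: nb.
  have ry : pauli n v0 v1 v2 y 0 0 = 1.
    have r1 : r y = psi (0, 0, 1).
      rewrite /r /pauli_radius /y /q sphere_point1 e0 e1 e2 /= !mulr0 expr0n !add0r mulr1.
      by rewrite sqrtr_sqr gtr0_norm.
    rewrite mxE -/(r y) r1 /= /y /q sphere_point1 e2 /= mulr1 -rmorphM /=.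
    by rewrite mulVf// gt_eqF.
  pose pr i := Re (p i y 0 0).
  have pr0 i : 0 <= pr i.
    by rewrite /pr projection_diag//; apply: sumr_ge0 => j _; exact: sqmod_ge0.
  have prs : \sum_i pr i <= 1.
    apply: (@projections_diag_le1 R _ _ (fun i => p i y) 0) => // j k jk.
    exact: porth.
  have E00 : Re (E y 0 0) = m y - \sum_i beta i y * pr i.
    rewrite EE mxE [X in X + _]mxE [X in _ + X]mxE ry mulr1 summxE ReB (raddf_sum (@complex.Re R : Rcomplex R -> R)).
    congr (_ - _); apply: eq_bigr => i _; rewrite mxE /pr.
    by case: (p i y 0 0) => a b /=; rewrite mul0r subr0.
  have sd : sqvec (delta_mx 0 0 : 'cV[R[i]]_n.+2) = 1.
    rewrite /sqvec (bigD1 0) //= big1 ?addr0 => [|j j0].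
      by rewrite mxE !eqxx /sqmod /= expr1n expr0n addr0.
    by rewrite mxE (negPf j0) /sqmod /= expr0n addr0.
  have := EP y (delta_mx 0 0); rewrite sd mulr1 -colE => h.
  have : Re (E y 0 0) ^+ 2 <= eps ^+ 2.
    apply: le_trans h; rewrite /sqvec (bigD1 0) //= [col _ _ _ _]mxE {1}/sqmod -addrA lerDl.
    by rewrite addr_ge0 ?sqr_ge0// sumr_ge0// => j _; exact: sqmod_ge0.
  move: (Re (E y 0 0)) E00 => x E00 x2.
  have {}x2 : x <= eps by rewrite leNgt; apply/negP => ?; nra.
  have : \sum_i beta i y * pr i <= m y / 2 * \sum_i pr i.
    by rewrite mulr_sumr; apply: ler_sum => i _; rewrite ler_wpM2r.
  have := epsm (1, 0) K1; rewrite -/y => h1 h2.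
  have my : 0 < m y / 2 := lt_trans eps0 h1.
  have : m y / 2 * \sum_i pr i <= m y / 2 by rewrite ler_piMr// ltW.
  lra.
have cp a b : continuous (fun y => p i y a b).
  have ci : continuous (p i) by exact: cts_fun.
  exact: (@continuous_mx_entry R Y _ _ (p i) a b ci).
(* Along the rays [p i] becomes a path of idempotents from a constant one at the origin to its
   restriction to the sphere. *)
pose P s k := p i (Phi (ray s (sphere_point k))).
have [v [cv Pv v0' ev]] : exists v : R * R -> 'cV[R[i]]_n.+2,
    [/\ forall j, continuous (fun k => v k j 0),
        forall k, P 1 k *m v k = v k,
        forall k, K k -> v k != 0 &
        forall k k', (forall s, P s k = P s k') -> v k = v k'].
  apply: (@idempotent_section R _ K _ P (p i (Phi (0, 0, 0)))) => //.
  - move=> a b; apply: (continuous_compose (cp a b)).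
    exact: (continuous_compose cPhi (@ray_sphere_point_continuous R)).
  - by move=> s k; exact: pp.
  - by move=> k; rewrite /P ray0.
  - by apply/eqP => h; have := prank i (Phi (0, 0, 0)); rewrite h mxrank0.
have pv k : p i (q k) *m v k = v k by have := Pv k; rewrite /P ray1.
(* As [v k] lies in the range of [p i], orthogonality removes the other projections, and [v k] is an
   approximate eigenvector for [beta i]. *)
have Ev k : E (q k) *m v k =
    ((m (q k))%:C *: pauli n v0 v1 v2 (q k)) *m v k - (beta i (q k))%:C *: v k.
  rewrite EE mulmxBl; congr (_ - _).
  rewrite mulmx_suml (bigD1 i) //= big1 ?addr0 -?scalemxAl ?pv// => j ji.
  by rewrite -scalemxAl -[v k]pv mulmxA porth// mul0mx scaler0.
have apx k := EP (q k) (v k).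
have sqv k : K k -> 0 < sqvec (v k).
  move=> Kk; rewrite lt_neqAle sqvec_ge0 andbT eq_sym; apply/eqP => h.
  by move: (v0' k Kk); rewrite (sqvec_eq0 h) eqxx.
have S0 (k : R * R) : 0 <= \sum_(j < n) sqmod (v k (lift 0 (lift 0 j)) 0).
  by apply: sumr_ge0 => j _; exact: sqmod_ge0.
have rn k : r (q k) != 0 by rewrite gt_eqF.
(* The inequality holds at the pole, and equality is excluded everywhere by [no_half_eigenvalue]. *)
have bK k : K k -> m (q k) / 2 < beta i (q k).
  move=> Kk; rewrite -subr_gt0.
  have [Ka Kb] := (KP k).1 Kk.
  apply: (@square_sign R (fun k => beta i (q k) - m (q k) / 2)) => //.
  - apply: continuousRB.
      have ca : continuous (alpha i) by exact: cts_fun.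
      exact: (continuous_compose cf (continuous_compose ca cq)).
    by apply: continuousRM => //; exact: cst_continuous.
  - by rewrite subr_gt0.
  - move=> {Kk Ka Kb}k Ka Kb; have Kk := (KP k).2 (conj Ka Kb).
    apply/eqP => /eqP; rewrite subr_eq0 => /eqP bm.
    have := apx k; rewrite Ev pauli_residualE ?rn// sqvec_split bm.
    apply: no_half_eigenvalue => //; last by rewrite -sqvec_split sqv.
      exact: normalized_sqr.
    exact: epsm.
have pos k : K k -> 0 < bloch (sphere_point k).1.1 (sphere_point k).1.2
    (sphere_point k).2 (v k 0 0) (v k (lift 0 0) 0).
  move=> Kk; have := apx k; rewrite Ev pauli_residualE ?rn// sqvec_split => h.
  have := bloch_gt0 (normalized_sqr (rn k)) eps0 (epsm k Kk) (bK k Kk) (S0 k) _ h.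
  rewrite -sqvec_split => /(_ (sqv k Kk)).
  rewrite e0 e1 e2 ![psi _ * _ / _]mulrAC blochZ pmulr_rgt0//.
  by rewrite divr_gt0.
apply: (@no_bloch_section R (fun k => v k 0 0) (fun k => v k (lift 0 0) 0)) => //.
  (* Parameters of the same sphere point share their ray, so the section descends to the sphere. *)
  by move=> k k' kk; rewrite (ev k k')// => s; rewrite /P kk.
by move=> k Ka Kb; apply: pos; apply/KP.
Qed.

(** * Coordinates on top cells, and the counterexample *)

Definition embed3 (R : realType) d (i0 i1 i2 : 'I_d) (p : R * R * R) : 'rV[R]_d :=
  \row_j (if j == i0 then p.1.1 else if j == i1 then p.1.2
          else if j == i2 then p.2 else 0).

Lemma embed3_continuous (R : realType) d (i0 i1 i2 : 'I_d) :
  continuous (@embed3 R d i0 i1 i2).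
Proof.
apply: mx_continuousP => i j.
rewrite (_ : (fun _ => _) = fun p : R * R * R => if j == i0 then p.1.1
  else if j == i1 then p.1.2 else if j == i2 then p.2 else 0); last first.
  by apply/funext => p; rewrite mxE.
case: (j == i0); first exact: continuous_compose (@continuous_fst _ _) (@continuous_fst _ _).
case: (j == i1); first exact: continuous_compose (@continuous_snd _ _) (@continuous_fst _ _).
by case: (j == i2); [exact: continuous_snd|exact: cst_continuous].
Qed.

Lemma bump_coordinate_continuous (R : realType) d (i : 'I_d) :
  continuous (fun w : 'rV[R]_d => (1 - sqnorm w) * w 0 i).
Proof.
apply: continuousRM; last exact: coord_continuous.
by apply: continuousRB; [exact: cst_continuous|exact: sqnorm_continuous].
Qed.

Lemma bump_coordinate_shrink (R : realType) d (i : 'I_d) (w : 'rV[R]_d) :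
  (1 - sqnorm (shrink w)) * shrink w 0 i =
  (1 - sqnorm (shrink w)) / (1 + sqnorm w) * w 0 i.
Proof. by rewrite mxE mulrA. Qed.

Lemma bump_factor_gt0 (R : realType) d (w : 'rV[R]_d) :
  0 < (1 - sqnorm (shrink w)) / (1 + sqnorm w).
Proof.
by rewrite divr_gt0 ?subr_gt0 ?sqnorm_shrink// ltr_wpDr// sqnorm_ge0.
Qed.

(** The function [(1 - |w|^2) w_i] vanishes on the boundary sphere, so it extends by zero. *)
Lemma top_cell_bump (R : realType) (X : topologicalType) (K : finite_cw R X)
    (e : cell K) (i : 'I_(cell_dim e)) :
  (forall e' : cell K, (cell_dim e' <= cell_dim e)%N) ->
  exists2 F : X -> R, continuous F & forall w : 'rV[R]_(cell_dim e),
    F (char_map (shrink w)) = (1 - sqnorm (shrink w)) / (1 + sqnorm w) * w 0 i.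
Proof.
move=> top; have [|F cF FE] := @extend_top_cell R X K e R _ 0 top
  (@bump_coordinate_continuous R _ i).
  by move=> w w1; rewrite w1 subrr mul0r.
exists F => // w; rewrite FE ?bump_coordinate_shrink//.
exact: ltW (sqnorm_shrink w).
Qed.

Theorem theorem7p9 (R : realType) (Y : topologicalType) (KY : finite_cw R Y)
    (n : nat) :
  (3 < cw_dim KY)%N -> (2 <= n)%N ->
  forall (X : topologicalType) (KX : finite_cw R X), (1 <= cw_dim KX)%N ->
  exists phi : cont R X -> cont_mx R Y n,
    unital_star_hom phi /\ ~ approximately_diagonalizable phi.
Proof.
move=> dY n2 X KX dX; case: n n2 => [|[|n]]// _.
have [eY dimY topY] := top_cell (ltn_trans (isT : (0 < 3)%N) dY).
have [eX dimX topX] := top_cell dX.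
have lt (k : nat) : (k < 3)%N -> (k < cell_dim eY)%N.
  by move=> k3; rewrite dimY (ltn_trans k3).
pose i0 := Ordinal (lt 0%N isT); pose i1 := Ordinal (lt 1%N isT).
pose i2 := Ordinal (lt 2%N isT).
have [v0 c0 v0E] := top_cell_bump i0 topY.
have [v1 c1 v1E] := top_cell_bump i1 topY.
have [v2 c2 v2E] := top_cell_bump i2 topY.
have kX : (0 < cell_dim eX)%N by rewrite dimX.
pose k0 := Ordinal kX.
have [f cf fE] := top_cell_bump k0 topX.
(* The path [gamma] follows a coordinate axis of the top cell of [X], on which [f] is a positive
   multiple of the parameter. *)
pose line (s : R) : 'rV[R]_(cell_dim eX) := s *: delta_mx 0 k0.
have cline : continuous line.
  apply: mx_continuousP => i j.
  rewrite (_ : (fun _ => _) = fun s : R => s * (delta_mx 0 k0 : 'rV[R]_(cell_dim eX)) i j).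
    by apply: continuousRM => s; [exact: cvg_id|exact: cst_continuous].
  by apply/funext => s; rewrite mxE.
have cgamma : continuous (fun s => char_map (shrink (line s)) : X).
  exact: continuous_compose (@continuous_char_map_shrink R X KX eX) cline.
have fgamma s : f (char_map (shrink (line s))) =
    (1 - sqnorm (shrink (line s))) / (1 + sqnorm (line s)) * s.
  by rewrite fE; congr (_ * _); rewrite !mxE !eqxx mulr1.
exists (pauli_hom n cgamma c0 c1 c2); split; first exact: pauli_hom_unital_star_hom.
(* One positive factor is common to the three coordinates of [v], so [v] is radial. *)
pose psi (p : R * R * R) := (1 - sqnorm (shrink (embed3 i0 i1 i2 p))) / (1 + sqnorm (embed3 i0 i1 i2 p)).
refine (@pauli_hom_not_diagonalizable R X Y n _ v0 v1 v2 cgamma c0 c1 c2 f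
  (fun p => char_map (shrink (embed3 i0 i1 i2 p))) psi cf _ _ _ _ _ _ _).
(* The positive factor in [fgamma] depends on the norm only, so it is even in [s]. *)
- have sN d (w : 'rV[R]_d) : sqnorm (- w) = sqnorm w.
    by rewrite -scaleN1r sqnormZ sqrrN expr1n mul1r.
  by move=> s; rewrite !fgamma mulrN /line scaleNr /shrink sN scalerN sN.
- by move=> s s0; rewrite fgamma mulr_gt0// bump_factor_gt0.
- exact: continuous_compose (@continuous_char_map_shrink R Y KY eY) (@embed3_continuous _ _ _ _ _).
- by move=> p; exact: bump_factor_gt0.
- by move=> p; rewrite v0E /psi !mxE eqxx.
- by move=> p; rewrite v1E /psi !mxE eqxx.
- by move=> p; rewrite v2E /psi !mxE eqxx.
Qed.
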